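(* For every $s\in\mathbb C\setminus\mathbb Z$ and every regularization parameter $T\in\mathbb C$, one has, as power series in $u$, $$\sum_{r=0}^{\infty}\mathcal T_*^T(\{1\}^r;s)\,u^r=\frac{\sin\pi(s+u)}{\sin\pi s}.$$ Consequently, $$\mathcal T_*^T(\{1\}^r;s)=\begin{cases}(-1)^m\dfrac{\pi^{2m}}{(2m)!},&r=2m,\\[6pt](-1)^m\dfrac{\pi^{2m+1}}{(2m+1)!}\cot(\pi s),&r=2m+1.\end{cases}$$ In particular, these functions are independent of $T$.
   Context: An index is a finite sequence $\boldsymbol{k}=(k_1,\dots,k_r)$ of positive integers, of depth $r$ and weight $|\boldsymbol{k}|=k_1+\cdots+k_r$; the empty index is $\varnothing$ (weight $0$); $\{1\}^r=(1,\dots,1)$ ($r$ entries), $\{1\}^0=\varnothing$. Reversal: $\overleftarrow{\boldsymbol{k}}=(k_r,\dots,k_1)$. Write $\boldsymbol{k}_{[1,j]}=(k_1,\dots,k_j)$, $\boldsymbol{k}_{(j,r]}=(k_{j+1},\dots,k_r)$, $\boldsymbol{k}_{[1,j)}=(k_1,\dots,k_{j-1})$, with $\boldsymbol{k}_{[1,0]}=\boldsymbol{k}_{(r,r]}=\boldsymbol{k}_{[1,1)}=\varnothing$. An index is admissible if it is empty or its last entry is $\geqslant2$. Stuffle regularization. For a nonempty admissible index $\boldsymbol{a}=(a_1,\dots,a_d)$, $\zeta(\boldsymbol{a};s)=\sum_{0<n_1<\cdots<n_d}\prod_{i}(n_i+s)^{-a_i}$, and $\zeta(\varnothing;s)=1$.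 On the $\mathbb Q$-span $\mathfrak H^1_*$ of all indices, the stuffle product $*$ is bilinear with unit $\varnothing$ and $(a,\boldsymbol{\alpha})*(b,\boldsymbol{\beta})=(a,\boldsymbol{\alpha}*(b,\boldsymbol{\beta}))+(b,(a,\boldsymbol{\alpha})*\boldsymbol{\beta})+(a+b,\boldsymbol{\alpha}*\boldsymbol{\beta})$; $\mathfrak H^0_*$ is the span of admissible indices. It is known that every index of depth $r$ has a unique decomposition $\boldsymbol{k}=\sum_{l=0}^r\boldsymbol{u}_l*(1)^{*l}$ with $\boldsymbol{u}_l\in\mathfrak H^0_*$. Define $\zeta_*^X(\boldsymbol{k};s)=\sum_{l=0}^r\zeta(\boldsymbol{u}_l;s)X^l$ (with $\zeta(\cdot;s)$ extended linearly); equivalently, $\zeta_*^X(\cdot;s)$ is the unique stuffle homomorphism extending $\zeta(\cdot;s)$ on admissible indices with $\zeta_*^X(1;s)=X$. Harmonic number function: $H(s)=\int_0^1\frac{1-t^s}{1-t}\,dt=\psi(1+s)+\gamma=\sum_{n\geqslant1}\bigl(\frac1n-\frac1{n+s}\bigr)$, extended meromorphically to $\mathbb C$. Regularized multitangent function: $$\mathcal T_*^T(\boldsymbol{k};s)=\sum_{j=0}^{r}(-1)^{|\boldsymbol{k}_{[1,j]}|}\zeta_*^{T-H(-s)}(\overleftarrow{\boldsymbol{k}_{[1,j]}};-s)\,\zeta_*^{T-H(s)}(\boldsymbol{k}_{(j,r]};s)+\sum_{j=1}^{r}\frac{(-1)^{|\boldsymbol{k}_{[1,j)}|}}{s^{k_j}}\zeta_*^{T-H(-s)}(\overleftarrow{\boldsymbol{k}_{[1,j)}};-s)\,\zeta_*^{T-H(s)}(\boldsymbol{k}_{(j,r]};s),$$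 with empty-index factors equal to $1$. *)

(* Defs.v *)
(* Mathematical Components with MathComp-Analysis: the complex field is R[i]
   for an arbitrary R : realType. *)
From HB Require Import structures.
From mathcomp Require Import all_boot all_order all_algebra.
From mathcomp Require Import all_classical all_reals all_analysis.
From mathcomp Require Import complex freeg.

Set Implicit Arguments.
Unset Strict Implicit.
Unset Printing Implicit Defensive.

Import Order.TTheory GRing.Theory Num.Theory numFieldNormedType.Exports.

Local Open Scope ring_scope.
Local Open Scope classical_set_scope.

(* R[i] packed as a numFieldType: MathComp-Analysis attaches the topology given
   by the modulus to numFieldType, not to [complex R] itself. *)
Definition CC (R : realType) : numFieldType := R[i].

Section ComplexTrigo.
Context {R : realType}.
Implicit Types z : CC R.

Definition Cpi : CC R := (@pi R)%:C%C.

Definition Cexp z : CC R :=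
  let: (x +i* y)%C := z in ((expR x * cos y) +i* (expR x * sin y))%C.

Definition Ci : CC R := (0 +i* 1)%C.

Definition Csin z : CC R := (Cexp (Ci * z) - Cexp (- (Ci * z))) / (2%:R * Ci).

Definition Ccos z : CC R := (Cexp (Ci * z) + Cexp (- (Ci * z))) / 2%:R.

Definition Ccot z : CC R := Ccos z / Csin z.

End ComplexTrigo.

(* An index is a [seq nat] all of whose entries are positive. Positivity is part
   of [admissible] and is not enforced by the type; a sequence with a zero entry
   is meaningless. *)
Notation mzindex := (seq nat).

Definition weight (k : mzindex) : nat := sumn k.

Definition admissible (k : mzindex) : bool :=
  all (leq 1) k && ((k == [::]) || (2 <= last 0%N k)%N).

Notation Hstuffle := {freeg (seq nat) / rat}.

Definition in_H0 (x : Hstuffle) : bool := all admissible (freeg.dom x).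

Definition prepend (a : nat) : Hstuffle -> Hstuffle :=
  fglift (fun w : mzindex => << a :: w >>).

Fixpoint stuffle_index (k : mzindex) : mzindex -> Hstuffle :=
  match k with
  | [::] => fun l => << l >>
  | a :: k' =>
      fix stuffle_a (l : mzindex) : Hstuffle :=
        match l with
        | [::] => << a :: k' >>
        | b :: l' => prepend a (stuffle_index k' (b :: l'))
                     + prepend b (stuffle_a l')
                     + prepend (a + b)%N (stuffle_index k' l')
        end
  end.

Definition stuffle (x y : Hstuffle) : Hstuffle :=
  fglift (fun k => fglift (fun l => stuffle_index k l) y) x.

Definition stuffle_exp (x : Hstuffle) (l : nat) : Hstuffle :=
  iter l (stuffle x) << ([::] : mzindex) >>.

(* k = sum_(0 <= l <= r) u_l * (1)^{*l} with every u_l in H^0, r = depth of k. *)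
Definition is_decomposition (k : mzindex)
    (u : {ffun 'I_(size k).+1 -> Hstuffle}) : Prop :=
  (forall l, in_H0 (u l)) /\
  << k >> = \sum_(l < (size k).+1)
              stuffle (u l) (stuffle_exp << [:: 1%N] >> l) :> Hstuffle.

(* Every index has exactly one decomposition, so the default value of [xget] is
   never used when the entries of k are positive. *)
Definition decomposition (k : mzindex) : {ffun 'I_(size k).+1 -> Hstuffle} :=
  xget [ffun=> 0] [set u | is_decomposition u].

Section Zeta.
Context {R : realType}.
Implicit Types (s X T : CC R) (k a : mzindex).

(* The part of the series for zeta(a; s) with 0 < n_1 < ... < n_d <= N; it is 1
   when a is empty. *)
Definition zeta_partial a s (N : nat) : CC R :=
  \sum_(n : (size a).-tuple 'I_N.+1 | path ltn 0%N [seq val i | i <- n])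
    \prod_(j < size a) ((tnth n j)%:R + s) ^- nth 0%N a j.

Definition zeta a s : CC R := lim (zeta_partial a s N @[N --> \oo]).

Definition zeta_lin (x : Hstuffle) s : CC R :=
  \sum_(a <- freeg.dom x) ratr (freeg.coeff a x) * zeta a s.

Definition zeta_reg X k s : CC R :=
  \sum_(l < (size k).+1) zeta_lin (decomposition k l) s * X ^+ l.

(* psi(1 + s) + gamma as the series sum_(n >= 1) (1/n - 1/(n+s)), which converges
   at every s that is not a negative integer. *)
Definition harmonic_fun s : CC R :=
  lim (series (fun n : nat => n.+1%:R^-1 - (n.+1%:R + s)^-1) @ \oo).

(* [take j k] and [drop j k] are k_[1,j] and k_(j,r]. The second sum is indexed by
   j - 1 in place of j, so that k_[1,j) is [take j k], k_j is [nth 0 k j] and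
   k_(j,r] is [drop j.+1 k]. *)
Definition multitangent T k s : CC R :=
  \sum_(j < (size k).+1)
    (-1) ^+ weight (take j k)
    * zeta_reg (T - harmonic_fun (- s)) (rev (take j k)) (- s)
    * zeta_reg (T - harmonic_fun s) (drop j k) s
  + \sum_(j < size k)
    (-1) ^+ weight (take j k) / s ^+ nth 0%N k j
    * zeta_reg (T - harmonic_fun (- s)) (rev (take j k)) (- s)
    * zeta_reg (T - harmonic_fun s) (drop j.+1 k) s.

End Zeta.

(* Main.v *)
Require Import Defs.
From HB Require Import structures.
From mathcomp Require Import all_boot all_order all_algebra.
From mathcomp Require Import all_classical all_reals all_analysis.
From mathcomp Require Import complex freeg.
From mathcomp Require Import ring lra zify.

Set Implicit Arguments.
Unset Strict Implicit.
Unset Printing Implicit Defensive.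

Import Order.TTheory GRing.Theory Num.Theory numFieldNormedType.Exports.

Local Open Scope ring_scope.
Local Open Scope classical_set_scope.

(** Write [Z(X, s; t)] for the generating series, in a formal variable [t], of the
regularized values [zeta_reg X (1,...,1) s], and [p_i(s)] for the sum of the
[(n + s)^(- i)] over [n > 0]. Since the index (1,...,1) of depth [r] plays the part
of the [r]th elementary symmetric function of the [1 / (n + s)], Newton's identities
give

   [Z(X, s; t) = exp (X t + sum_(i >= 2) (-1)^(i - 1) p_i(s) t^i / i)].

By definition the generating series of the [multitangent T (1,...,1) s] is
[(1 + t / s) Z(T - H(- s), - s; - t) Z(T - H(s), s; t)]. Taking logarithmic
derivatives, [T] cancels, the two harmonic functions combine into the conditionally
convergent sum of the [1 / (s + n)], and one finds the formal counterpart of the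
product of the [1 + t / (s + n)] over all integers [n], that is, of
[sin (s + t) pi / sin s pi]. Three points have to be justified.

The regularized values ([log_deriv_zeta_reg]). They are defined by a decomposition
of (1,...,1) along the powers of (1) in the stuffle algebra, so that this
decomposition must be found and shown to be unique. Both rest on sums of words
whose coefficients are products over the letters: stuffle multiplies them like
products of power series in independent variables ([letterwise_conv]). In this
calculus (1,...,1) corresponds to [1 + t], the divided powers of (1) to [exp t], and
the quotient [(1 + t) exp (- t)] has no linear term, hence involves admissible
indices only ([decomposition_ones]). Uniqueness holds because removing a last
letter 1 is a derivation that kills the admissible indices ([stuffle_exp_free]).
Truncated zeta values of letterwise sums are finite products, whose logarithmic
derivatives are power sums ([log_deriv_nested]), and one passes to the limit.

The product ([multitangent_ones_value]). Newton's recursion determines the values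
from the sums of the [(s + n)^(- i)]. These sums are limits of the power sums of
[M = 2 N + 1] numbers [(pi / M) cot (pi (s + k) / M)] with [|k| <= N], by Tannery's
theorem and a domination by [1 / k^2] of the paired terms ([cvg_cot_power_sum]).
The elementary symmetric functions of these cotangents are known exactly, by the
factorization of a difference of [M]th powers ([elementary_cayley_cot]): up to
sign and a factor 1 or [cot (pi s)], they are [binomial (M, r) (pi / M)^r], which
tends to [pi^r / r!]. As limits preserve Newton's recursion, this gives the closed forms.

The generating function. It follows from the closed forms by the exponential
series of a complex number ([cvg_exp_series]), a Cauchy product of the exponential
series of its real part with the cosine and sine series of its imaginary part. *)

(** * Sequences as formal power series *)

Section PowerSeries.
Variable K : comNzRingType.
Implicit Types (f g h q : nat -> K) (p : {poly K}).

Definition conv f g (n : nat) : K := \sum_(i < n.+1) f i * g (n - i)%N.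

Definition trunc f (n : nat) : {poly K} := \poly_(i < n.+1) f i.

Lemma coef_trunc f n i : (i <= n)%N -> (trunc f n)`_i = f i.
Proof. by move=> lein; rewrite coef_poly ltnS lein. Qed.

Lemma coef_mul_trunc f g n i :
  (i <= n)%N -> (trunc f n * trunc g n)`_i = conv f g i.
Proof.
move=> lein; rewrite coefM; apply: eq_bigr => j _.
have leji : (j <= i)%N by rewrite -ltnS.
by rewrite !coef_trunc ?(leq_trans _ lein) ?leq_subr.
Qed.

Lemma eq_conv f f' g g' n : (forall i, (i <= n)%N -> f i = f' i) ->
  (forall i, (i <= n)%N -> g i = g' i) -> conv f g n = conv f' g' n.
Proof.
by move=> ff' gg'; apply: eq_bigr => i _; rewrite ff' ?gg' ?leq_subr -1?ltnS.
Qed.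

Lemma conv0 f g : conv f g 0 = f 0%N * g 0%N.
Proof. by rewrite /conv big_ord1. Qed.

Lemma convC f g n : conv f g n = conv g f n.
Proof. by rewrite -(coef_mul_trunc f g (leqnn n)) mulrC coef_mul_trunc. Qed.

Lemma convA f g h n : conv f (conv g h) n = conv (conv f g) h n.
Proof.
have -> : conv f (conv g h) n = (trunc f n * (trunc g n * trunc h n))`_n.
  rewrite coefM; apply: eq_bigr => i _.
  by rewrite coef_trunc -1?ltnS // coef_mul_trunc ?leq_subr.
rewrite mulrA coefM; apply: eq_bigr => i _.
by rewrite coef_mul_trunc -1?ltnS // coef_trunc ?leq_subr.
Qed.

Definition linear_series (x : K) (n : nat) : K := [:: 1; x]`_n.

Definition unit_series : nat -> K := linear_series 0.

Lemma conv_linearS x f n : conv (linear_series x) f n.+1 = f n.+1 + x * f n.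
Proof.
rewrite /conv big_ord_recl /= subn0 mul1r big_ord_recl /= subn1 /=.
by rewrite big1 ?addr0 // => i _; rewrite /linear_series /= nth_nil mul0r.
Qed.

Lemma conv1s f n : conv unit_series f n = f n.
Proof.
case: n => [|n]; first by rewrite conv0 mul1r.
by rewrite conv_linearS mul0r addr0.
Qed.

(** [log_deriv f q] says that [f] has constant term 1 and [f' = q f]. When [f]
is the product of the [1 + x_n t], the coefficients of [q] are the signed power
sums of the [x_n], so that the recursion below is the one of Newton between
elementary symmetric functions and power sums. *)
Definition log_deriv f q : Prop :=
  f 0%N = 1 /\ forall n, f n.+1 *+ n.+1 = conv q f n.

Lemma log_deriv_unit : log_deriv unit_series (fun=> 0).
Proof.
split=> // n; rewrite /unit_series /linear_series.
rewrite /conv big1 => [|i _]; last by rewrite mul0r.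
by case: n => [|n]; rewrite /= ?nth_nil ?mul0rn ?mulr1n.
Qed.

Lemma log_deriv_linear x :
  log_deriv (linear_series x) (fun i => (-1) ^+ i * x ^+ i.+1).
Proof.
split=> // n; rewrite convC; case: n => [|n].
  by rewrite conv0 expr0 expr1 mul1r mulr1n /linear_series /= mul1r.
by rewrite conv_linearS /linear_series /= nth_nil mul0rn !exprS; ring.
Qed.

Lemma log_deriv_conv f g q q' : log_deriv f q -> log_deriv g q' ->
  log_deriv (conv f g) (fun i => q i + q' i).
Proof.
move=> [f0 fS] [g0 gS]; split=> [|n]; first by rewrite conv0 f0 g0 mulr1.
have -> : conv f g n.+1 *+ n.+1 =
    conv (fun i => f i.+1 *+ i.+1) g n + conv f (fun i => g i.+1 *+ i.+1) n.
  rewrite -(coef_mul_trunc f g (leqnn n.+1)) -coef_deriv derivM coefD !coefM.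
  congr (_ + _); apply: eq_bigr => -[i /= lein] _;
    by rewrite coef_deriv !coef_trunc //; lia.
have -> : conv (fun i => f i.+1 *+ i.+1) g n = conv q (conv f g) n.
  by rewrite convA; apply: eq_conv => // i _; exact: fS.
have -> : conv f (fun i => g i.+1 *+ i.+1) n = conv q' (conv f g) n.
  transitivity (conv f (conv q' g) n); first by apply: eq_conv.
  by rewrite !convA; apply: eq_conv => // i _; exact: convC.
by rewrite /conv -big_split /=; apply: eq_bigr => i _; rewrite mulrDl.
Qed.

Lemma log_deriv_prod (x : nat -> K) (s : seq nat) :
  log_deriv (fun i => (\prod_(n <- s) (1 + x n *: 'X))`_i)
    (fun i => (-1) ^+ i * \sum_(n <- s) x n ^+ i.+1).
Proof.
have ext f g q q' : f =1 g -> q =1 q' -> log_deriv g q' -> log_deriv f q.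
  by move=> /funext -> /funext ->.
elim: s => [|n s IHs].
  apply: (ext _ _ _ _ _ _ log_deriv_unit) => i; last by rewrite big_nil mulr0.
  rewrite big_nil coef1 /unit_series /linear_series.
  by case: i => [|[|i]] //=; rewrite nth_nil.
apply: (ext _ _ _ _ _ _ (log_deriv_conv (log_deriv_linear (x n)) IHs)) => i; last first.
  by rewrite big_cons mulrDr.
rewrite big_cons coefM; apply: eq_bigr => j _; congr (_ * _).
rewrite coefD coef1 coefZ coefX /linear_series.
by case: (nat_of_ord j) => [|[|k]] /=;
  rewrite ?mulr0 ?addr0 ?mulr1 ?add0r ?nth_nil.
Qed.

(** The logarithmic derivative of [f(x t)] is [x q(x t)]. *)
Lemma log_deriv_scale f q x : log_deriv f q ->
  log_deriv (fun i => x ^+ i * f i) (fun i => x ^+ i.+1 * q i).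
Proof.
move=> [f0 fS]; split=> [|n]; first by rewrite f0 mulr1.
rewrite -mulrnAr fS /conv mulr_sumr; apply: eq_bigr => i _.
have -> : x ^+ n.+1 = x ^+ i.+1 * x ^+ (n - i) :> K.
  by rewrite -exprD addSn subnKC // -ltnS.
by ring.
Qed.

End PowerSeries.

Lemma log_deriv_map (K L : comNzRingType) (h : {rmorphism K -> L}) f q :
  log_deriv f q -> log_deriv (h \o f) (h \o q).
Proof.
move=> [f0 fS]; split=> [|n] /=; first by rewrite f0 rmorph1.
by rewrite -rmorphMn fS rmorph_sum; apply: eq_bigr => i _; rewrite rmorphM.
Qed.

Section CharacteristicZero.
Variable K : numFieldType.
Implicit Types (f g q : nat -> K).

Lemma log_deriv_unique f g q : log_deriv f q -> log_deriv g q -> f =1 g.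
Proof.
move=> [f0 fS] [g0 gS] n; elim/ltn_ind: n => -[|n] IH; first by rewrite f0.
apply: (@mulIf _ n.+1%:R); first by rewrite pnatr_eq0.
by rewrite !mulr_natr fS gS; apply: eq_conv.
Qed.

Definition exp_series (x : K) (n : nat) : K := x ^+ n / n`!%:R.

Lemma exp_series0 x : exp_series x 0 = 1.
Proof. by rewrite /exp_series expr0 mul1r invr1. Qed.

Lemma exp_seriesS x n : exp_series x n.+1 *+ n.+1 = x * exp_series x n.
Proof.
rewrite -[LHS]mulr_natr /exp_series factS natrM exprS.
have n0 : n.+1%:R != 0 :> K by rewrite pnatr_eq0.
have f0 : n`!%:R != 0 :> K by rewrite pnatr_eq0 -lt0n fact_gt0.
by move: n.+1%:R n`!%:R n0 f0 => a b a0 b0; field; rewrite a0 b0.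
Qed.

Lemma log_deriv_exp x : log_deriv (exp_series x) (fun i => if i is 0 then x else 0).
Proof.
split=> [|n]; first exact: exp_series0.
rewrite exp_seriesS /conv big_ord_recl subn0 big1 ?addr0 // => i _.
by rewrite mul0r.
Qed.

(** Exponentials multiply by adding their arguments: both sides have the same
logarithmic derivative. *)
Lemma conv_exp x y : conv (exp_series x) (exp_series y) =1 exp_series (x + y).
Proof.
apply: (@log_deriv_unique _ _ (fun i => if i is 0 then x + y else 0)).
  have [h0 hS] := log_deriv_conv (log_deriv_exp x) (log_deriv_exp y).
  split=> // n; rewrite hS; apply: eq_conv => // -[|i] _ //.
  by rewrite addr0.
exact: log_deriv_exp.
Qed.

End CharacteristicZero.

(** * The stuffle algebra *)

Section DoubleSums.
Variable V : nmodType.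

Definition sum2 (n : nat) (F : nat -> nat -> V) : V :=
  \sum_(i < n.+1) F i (n - i)%N.

Lemma eq_sum2 n F F' : (forall i j, (i + j)%N = n -> F i j = F' i j) ->
  sum2 n F = sum2 n F'.
Proof. by move=> FF'; apply: eq_bigr => i _; rewrite FF' // subnKC // -ltnS. Qed.

Lemma sum2C n F : sum2 n F = sum2 n (fun i j => F j i).
Proof.
rewrite /sum2 (reindex_inj rev_ord_inj) /=; apply: eq_bigr => i _.
by rewrite subSS subKn // -ltnS.
Qed.

Lemma sum2A n (X : nat -> nat -> nat -> V) :
  sum2 n (fun i k => sum2 i (fun a b => X a b k)) =
  sum2 n (fun a j => sum2 j (fun b k => X a b k)).
Proof.
rewrite /sum2.
under eq_bigr => i _.
  rewrite (big_ord_widen_cond n.+1 (fun=> true)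
    (fun a : nat => X a (i - a)%N (n - i)%N)) //=; over.
rewrite (exchange_big_dep predT) //=; apply: eq_bigr => a _.
under eq_bigl do rewrite ltnS.
rewrite -(big_mkord (fun i => (a <= i)%N) (fun i => X a (i - a)%N (n - i)%N)).
rewrite -(big_nat_widenl a 0%N n.+1 predT) //= -{1}[nat_of_ord a]add0n big_addn.
rewrite subSn -1?ltnS // big_mkord; apply: eq_bigr => b _.
by rewrite addnK [(b + a)%N]addnC subnDA.
Qed.

End DoubleSums.

(** Both sides sum [F] over the quadruples of total [n]: reassociating
the sums and swapping the middle indices exchanges the two groupings. *)
Lemma sum2_interchange (V : nmodType) n (F : nat -> nat -> nat -> nat -> V) :
  sum2 n (fun i j => sum2 i (fun a p => sum2 j (fun b q => F a b p q))) =
  sum2 n (fun c m => sum2 c (fun a b => sum2 m (fun p q => F a b p q))).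
Proof.
rewrite (sum2A n (fun a p j => sum2 j (fun b q => F a b p q))).
rewrite (sum2A n (fun a b m => sum2 m (fun p q => F a b p q))).
apply: eq_sum2 => a m _.
rewrite -(sum2A m (fun p b q => F a b p q)) -(sum2A m (fun b p q => F a b p q)).
by apply: eq_sum2 => k q _; rewrite sum2C.
Qed.

Section LinearExtension.
Variables (M : lmodType rat) (f : seq nat -> M).

HB.instance Definition _ :=
  GRing.isAdditive.Build Hstuffle M (fglift f) (lift_is_additive f).

Lemma fglift_scalable : scalable (fglift f).
Proof.
move=> c x; rewrite -[in RHS](freeg_sumE x) !raddf_sum.
by apply: eq_bigr => k _; rewrite /= !liftU scalerA.
Qed.

HB.instance Definition _ :=
  GRing.isScalable.Build rat Hstuffle M *:%R (fglift f) fglift_scalable.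

Lemma fglift_word k : fglift f << k >> = f k.
Proof. by rewrite liftU scale1r. Qed.

End LinearExtension.

Lemma word_expansion (x : Hstuffle) :
  x = \sum_(k <- freeg.dom x) coeff k x *: << k >>.
Proof.
rewrite -[LHS]freeg_sumE; apply: eq_bigr => k _.
by apply/eqP/freeg_eqP => l; rewrite coeffZ !coeffU mul1r.
Qed.

HB.instance Definition _ a := GRing.Linear.copy (prepend a) (fglift _).

Lemma stuffle_suml I (r : seq I) (F : I -> Hstuffle) y :
  stuffle (\sum_(i <- r) F i) y = \sum_(i <- r) stuffle (F i) y.
Proof. exact: linear_sum. Qed.

Lemma stuffleZl c x y : stuffle (c *: x) y = c *: stuffle x y.
Proof. exact: linearZ_LR. Qed.

Lemma stuffle_is_linear x : linear (stuffle x).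
Proof.
move=> c y z; rewrite (word_expansion x) /stuffle !linear_sum.
rewrite -big_split; apply: eq_bigr => k _ /=.
by rewrite !linearZ /= !fglift_word linearP scalerDr !scalerA mulrC.
Qed.

HB.instance Definition _ x :=
  GRing.isLinear.Build rat Hstuffle Hstuffle *:%R (stuffle x)
    (stuffle_is_linear x).

Lemma stuffle_sumr I (r : seq I) x (F : I -> Hstuffle) :
  stuffle x (\sum_(i <- r) F i) = \sum_(i <- r) stuffle x (F i).
Proof. exact: linear_sum. Qed.

Lemma stuffleZr c x y : stuffle x (c *: y) = c *: stuffle x y.
Proof. exact: linearZ_LR. Qed.

Lemma prepend_sum I (r : seq I) a (F : I -> Hstuffle) :
  prepend a (\sum_(i <- r) F i) = \sum_(i <- r) prepend a (F i).
Proof. exact: linear_sum. Qed.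

Lemma prependZ a c x : prepend a (c *: x) = c *: prepend a x.
Proof. exact: linearZ_LR. Qed.

Lemma prepend_word a k : prepend a << k >> = << a :: k >>.
Proof. exact: fglift_word. Qed.

Lemma stuffle_words k l : stuffle << k >> << l >> = stuffle_index k l.
Proof. by rewrite /stuffle !fglift_word. Qed.

(* A scaled element unfolds to a sum: the rules for scaling come first. *)
Definition stuffle_lin :=
  (stuffleZl, stuffleZr, prependZ, stuffle_suml, stuffle_sumr, prepend_sum).

Lemma stuffle1x y : stuffle << [::] >> y = y.
Proof.
rewrite (word_expansion y) stuffle_sumr; apply: eq_bigr => k _.
by rewrite stuffleZr stuffle_words.
Qed.

Lemma stufflex1 x : stuffle x << [::] >> = x.
Proof.
rewrite (word_expansion x) stuffle_suml; apply: eq_bigr => k _.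
by rewrite stuffleZl stuffle_words; case: k.
Qed.

Lemma stuffle_prepend a b x y :
  stuffle (prepend a x) (prepend b y) =
    prepend a (stuffle x (prepend b y)) + prepend b (stuffle (prepend a x) y)
    + prepend (a + b) (stuffle x y).
Proof.
rewrite (word_expansion x) !stuffle_lin -!big_split.
apply: eq_bigr => k _ /=.
rewrite !stuffle_lin -!scalerDr; congr (_ *: _).
rewrite (word_expansion y) !stuffle_lin -!big_split.
apply: eq_bigr => l _ /=; rewrite !stuffle_lin -!scalerDr; congr (_ *: _).
by rewrite !prepend_word !stuffle_words.
Qed.

(** The letter 0 is sent to 0, so that a sum over the first letter of a word of
weight [n] can run over all pairs of total [n], as a convolution does. *)
Definition prepend_pos a : Hstuffle -> Hstuffle :=
  if a is 0 then \0 else prepend a.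

Lemma prepend_pos_is_linear a : linear (prepend_pos a).
Proof.
by case: a => [|a] c x y; [rewrite /= scaler0 addr0|rewrite /= linearP].
Qed.

HB.instance Definition _ a :=
  GRing.isLinear.Build rat Hstuffle Hstuffle *:%R (prepend_pos a)
    (prepend_pos_is_linear a).

Section Letterwise.
Implicit Types (phi psi : nat -> rat).

Fixpoint letterwise_rec (fuel : nat) phi (n : nat) : Hstuffle :=
  if (n, fuel) is (n'.+1, fuel'.+1) then
    \sum_(i < n) phi i.+1 *: prepend i.+1 (letterwise_rec fuel' phi (n' - i))
  else << [::] >>.

(** The component of weight [n] of the sum of all words [(k_1,...,k_d)] with
coefficients [phi k_1 * ... * phi k_d]. It is the stuffle counterpart of the
product of the power series [1 + phi 1 x_n + phi 2 x_n^2 + ...] over independent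
variables [x_n]. *)
Definition letterwise phi n := letterwise_rec n phi n.

Arguments letterwise : simpl never.

Lemma letterwise0 phi : letterwise phi 0 = << [::] >>.
Proof. by []. Qed.

Lemma letterwiseS phi n : letterwise phi n.+1 =
  \sum_(i < n.+1) phi i.+1 *: prepend i.+1 (letterwise phi (n - i)).
Proof.
have fuelE m m' i : (i <= m)%N -> (i <= m')%N ->
    letterwise_rec m phi i = letterwise_rec m' phi i.
  elim: m m' i => [|m IHm] [|m'] [|i] //=; rewrite !ltnS => lem lem'.
  apply: eq_bigr => j _; congr (_ *: prepend _ _).
  by apply: IHm; exact: leq_trans (leq_subr _ _) _.
rewrite /letterwise /=; apply: eq_bigr => i _; congr (_ *: prepend _ _).
by apply: fuelE => //; exact: leq_subr.
Qed.

Lemma letterwise_sum2 phi n : letterwise phi n.+1 =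
  sum2 n.+1 (fun a m => phi a *: prepend_pos a (letterwise phi m)).
Proof.
rewrite letterwiseS /sum2 [RHS]big_ord_recl /= scaler0 add0r.
by apply: eq_bigr => i _; rewrite /bump /= subSS.
Qed.

(** The first letter of a stuffle comes from the left factor, from the right one,
or from both. These three sums are one sum over pairs [(a, b)] of letters, where
0 stands for taking no letter from that factor. *)
Lemma stuffle_letterwise phi psi i j : phi 0%N = 1 -> psi 0%N = 1 ->
  (0 < i + j)%N ->
  stuffle (letterwise phi i) (letterwise psi j) =
    sum2 i (fun a p => sum2 j (fun b q =>
      (phi a * psi b) *:
        prepend_pos (a + b) (stuffle (letterwise phi p) (letterwise psi q)))).
Proof.
move=> phi0 psi0; case: i => [|i]; case: j => [|j] // _.
- rewrite stuffle1x {1}/sum2 big_ord1 letterwise_sum2.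
  by apply: eq_sum2 => a p _; rewrite phi0 mul1r stuffle1x.
- rewrite stufflex1 letterwise_sum2; apply: eq_sum2 => a p _.
  by rewrite /sum2 big_ord1 psi0 mulr1 addn0 stufflex1.
rewrite /sum2 [RHS]big_ord_recl [X in X + _]big_ord_recl /= phi0 scaler0 add0r.
under [X in _ + X]eq_bigr => a _ do rewrite big_ord_recl /= psi0 mulr1 addn0.
rewrite big_split /=.
rewrite {1}[letterwise phi i.+1]letterwiseS stuffle_suml.
under [LHS]eq_bigr => a _.
  rewrite stuffleZl letterwiseS stuffle_sumr scaler_sumr.
  under eq_bigr => b _.
    rewrite stuffleZr stuffle_prepend !scalerDr !scalerA; over.
  rewrite !big_split /=; over.
rewrite !big_split /=; rewrite addrAC -addrA [RHS]addrCA.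
congr (_ + _).
  apply: eq_bigr => a _; rewrite /bump /= subSS letterwiseS !stuffle_lin.
  by rewrite scaler_sumr; apply: eq_bigr => b _; rewrite !stuffle_lin scalerA.
rewrite addrC; congr (_ + _).
  rewrite exchange_big; apply: eq_bigr => b _ /=.
  rewrite letterwiseS !stuffle_lin scaler_sumr mul1r.
  by apply: eq_bigr => a _; rewrite !stuffle_lin scalerA mulrC.
Qed.

(** The counterpart of multiplying two products over the same variables. *)
Lemma letterwise_conv phi psi n : phi 0%N = 1 -> psi 0%N = 1 ->
  \sum_(i < n.+1) stuffle (letterwise phi i) (letterwise psi (n - i)) =
    letterwise (conv phi psi) n.
Proof.
move=> phi0 psi0.
elim/ltn_ind: n => -[_|n IH]; first by rewrite big_ord1 stuffle1x.
rewrite letterwise_sum2 -/(sum2 n.+1 (fun i j =>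
  stuffle (letterwise phi i) (letterwise psi j))).
under eq_sum2 => i j ij.
  by rewrite stuffle_letterwise //; [over|rewrite ij].
rewrite sum2_interchange; apply: eq_sum2 => c m cm.
case: c cm => [|c] cm.
  by rewrite /= scaler0 /sum2 big_ord1 big1 // => i _; rewrite /= scaler0.
rewrite -IH; last by rewrite -cm addSn ltnS leq_addl.
rewrite linear_sum /conv scaler_suml; apply: eq_bigr => a _.
rewrite scaler_sumr; apply: eq_bigr => p _.
by rewrite subnKC // -ltnS.
Qed.

End Letterwise.

(** A word of the product arises by inserting a letter 1 or by increasing a letter
[b - 1] to [b]. As [1 / (b - 1)! = b / b!], each letter [b]
contributes [b] times the coefficient of the word, and the letters add up to the
weight. *)
Lemma stuffle_one_exp n :
  stuffle << [:: 1%N] >> (letterwise (exp_series 1) n) =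
    letterwise (exp_series 1) n.+1 *+ n.+1.
Proof.
have e_rec a : exp_series 1 a.+1 *+ a.+1 = exp_series 1 a :> rat.
  by rewrite exp_seriesS mul1r.
set e := exp_series (1 : rat) in e_rec *.
have e1 : e 1%N = 1 by rewrite -[LHS]mulr1n e_rec /e exp_series0.
elim/ltn_ind: n => -[_|n IH].
  rewrite letterwise0 stufflex1 letterwiseS big_ord1 e1 scale1r.
  by rewrite prepend_word mulr1n.
rewrite letterwiseS -prepend_word stuffle_sumr.
under eq_bigr => a _.
  rewrite stuffleZr stuffle_prepend stuffle1x prepend_word IH; last first.
    by rewrite ltnS leq_subr.
  rewrite raddfMn stuffle1x !scalerDr -[X in X + _ + _]prependZ; over.
rewrite !big_split /= -prepend_sum -letterwiseS.
rewrite [letterwise e n.+2]letterwiseS -sumrMnl.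
rewrite [in X in _ + X + _]/=.
have -> : \sum_(i < n.+2) e i.+1 *: prepend i.+1 (letterwise e (n.+1 - i)) *+ n.+2 =
  \sum_(i < n.+2) e i.+1 *: prepend i.+1 (letterwise e (n.+1 - i)) *+ (n.+1 - i)
  + \sum_(i < n.+2) e i.+1 *: prepend i.+1 (letterwise e (n.+1 - i)) *+ i.+1.
  rewrite -big_split; apply: eq_bigr => -[i /= ilt] _.
  by rewrite -mulrnDr; congr (_ *+ _); lia.
rewrite addrAC [RHS]addrC; congr (_ + _).
  rewrite [RHS]big_ord_recl /= e1 scale1r mulr1n subn0; congr (_ + _).
  by apply: eq_bigr => i _; rewrite /bump /= subSS scalerMnl e_rec.
rewrite [RHS]big_ord_recr /= subnn mulr0n addr0.
by apply: eq_bigr => -[i /= ilt] _; rewrite scalerMnr subSn.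
Qed.

Lemma stuffle_exp_letterwise n :
  stuffle_exp << [:: 1%N] >> n = letterwise (exp_series 1) n *+ n`!.
Proof.
elim: n => [|n IHn]; first by rewrite mulr1n.
by rewrite /stuffle_exp iterS -/(stuffle_exp _ _) IHn raddfMn /=
  stuffle_one_exp -mulrnA.
Qed.

(** * Decompositions along the powers of the index (1) *)

Fixpoint drop_one_word (k : seq nat) : Hstuffle :=
  if k is a :: w then
    prepend a (drop_one_word w) + ((a == 1%N) && (w == [::]))%:R *: << [::] >>
  else 0.

(** Removes a last letter equal to 1, and kills the words that do not end in 1.
On words with positive letters it is a derivation for the stuffle product,
because a letter [a + b] made by merging two letters is never 1. It kills the
admissible indices and maps the index (1) to 1, hence it acts on a polynomial
in (1) with admissible coefficients as the derivative with respect to (1). *)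
Definition drop_one : Hstuffle -> Hstuffle := fglift drop_one_word.

HB.instance Definition _ := GRing.Linear.copy drop_one (fglift drop_one_word).

Lemma drop_one_wordE k : drop_one << k >> = drop_one_word k.
Proof. exact: fglift_word. Qed.

Lemma drop_one_prepend a x : drop_one (prepend a x) =
  prepend a (drop_one x) + ((a == 1%N)%:R * coeff [::] x) *: << [::] >>.
Proof.
rewrite {1 2}(word_expansion x).
have -> : coeff [::] x =
    \sum_(k <- freeg.dom x) coeff k x * (k == [::])%:R.
  rewrite {1}(word_expansion x) raddf_sum; apply: eq_bigr => k _.
  by rewrite /= coeffZ coeffU mul1r.
rewrite mulr_sumr scaler_suml !linear_sum -big_split; apply: eq_bigr => k _ /=.
rewrite !linearZ_LR /= prepend_word !drop_one_wordE /= scalerDr !scalerA.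
by congr (_ + _ *: _); case: eqP; case: eqP => _ _; rewrite ?mulr0 ?mul1r ?mulr1
  ?mul0r.
Qed.

Lemma coeff_nil_prepend a x : coeff [::] (prepend a x) = 0.
Proof.
rewrite (word_expansion x) linear_sum raddf_sum big1 // => k _ /=.
by rewrite linearZ_LR /= prepend_word coeffZ coeffU /= !mulr0.
Qed.

Lemma coeff_nil_letterwiseS phi n : coeff [::] (letterwise phi n.+1) = 0.
Proof.
rewrite letterwiseS raddf_sum big1 // => i _ /=.
by rewrite coeffZ coeff_nil_prepend mulr0.
Qed.

Lemma coeff_nil_stuffle_cons a w y : coeff [::] (stuffle << a :: w >> y) = 0.
Proof.
rewrite (word_expansion y) linear_sum raddf_sum big1 // => l _ /=.
rewrite linearZ_LR /= stuffle_words coeffZ; case: l => [|b l].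
  by rewrite coeffU /= !mulr0.
by rewrite /= !coeffD !coeff_nil_prepend !addr0 mulr0.
Qed.

(** The multiple of [letterwise phi] by the variable of the series: a shift. *)
Definition letterwise_pred phi n : Hstuffle :=
  if n is n'.+1 then letterwise phi n' else 0.

Lemma letterwise_predS phi n : letterwise_pred phi n =
  \sum_(i < n) phi i.+1 *: prepend i.+1 (letterwise_pred phi (n.-1 - i)%N)
  + (n == 1%N)%:R *: << [::] >>.
Proof.
case: n => [|[|n]] /=; first by rewrite big_ord0 scale0r addr0.
  by rewrite big_ord1 /= linear0 scaler0 add0r scale1r.
rewrite scale0r addr0 letterwiseS [RHS]big_ord_recr /= subnn /= linear0 scaler0.
by rewrite addr0; apply: eq_bigr => -[i /= ilt] _; rewrite subSn.
Qed.

Lemma stuffle_prepend_letterwise a x phi n :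
  stuffle (prepend a x) (letterwise phi n) =
    prepend a (stuffle x (letterwise phi n)) +
    \sum_(i < n) phi i.+1 *:
      (prepend i.+1 (stuffle (prepend a x) (letterwise phi (n.-1 - i))) +
       prepend (a + i.+1) (stuffle x (letterwise phi (n.-1 - i)))).
Proof.
case: n => [|n]; first by rewrite !stufflex1 big_ord0 addr0.
rewrite letterwiseS !stuffle_lin -big_split.
apply: eq_bigr => i _ /=.
by rewrite !stuffle_lin stuffle_prepend -scalerDr addrA.
Qed.

Lemma stuffle_prepend_letterwise_pred a x phi n :
  stuffle (prepend a x) (letterwise_pred phi n) =
    prepend a (stuffle x (letterwise_pred phi n)) +
    \sum_(i < n) phi i.+1 *:
      (prepend i.+1 (stuffle (prepend a x) (letterwise_pred phi (n.-1 - i))) +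
       prepend (a + i.+1) (stuffle x (letterwise_pred phi (n.-1 - i)))).
Proof.
case: n => [|n]; first by rewrite big_ord0 addr0 !linear0.
rewrite stuffle_prepend_letterwise [in RHS]big_ord_recr /= subnn /=.
rewrite !(linear0 (stuffle _), linear0 (prepend _)) addr0 scaler0 addr0.
congr (_ + _); apply: eq_bigr => -[i /= ilt] _.
by case: n ilt => // n ilt; rewrite [in RHS]subSn.
Qed.

Lemma drop_one_sum I (r : seq I) (F : I -> Hstuffle) :
  drop_one (\sum_(i <- r) F i) = \sum_(i <- r) drop_one (F i).
Proof. exact: linear_sum. Qed.

Lemma drop_oneZ c x : drop_one (c *: x) = c *: drop_one x.
Proof. exact: linearZ_LR. Qed.

Lemma drop_oneD x y : drop_one (x + y) = drop_one x + drop_one y.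
Proof. exact: linearD. Qed.

Lemma drop_one_letterwise phi n :
  drop_one (letterwise phi n) = phi 1%N *: letterwise_pred phi n.
Proof.
elim/ltn_ind: n => -[_|n IH]; first by rewrite drop_one_wordE scaler0.
rewrite letterwiseS drop_one_sum [in RHS]letterwise_predS.
under eq_bigr => i _.
  rewrite drop_oneZ drop_one_prepend IH ?ltnS ?leq_subr // prependZ scalerDr.
  over.
rewrite big_split /= scalerDr scaler_sumr; congr (_ + _).
  by apply: eq_bigr => i _; rewrite !scalerA mulrC.
rewrite big_ord_recl /= big1 => [|i _]; last by rewrite !mul0r scale0r scaler0.
rewrite addr0 subn0 mul1r; congr (_ *: (_ *: _)).
by case: n {IH} => [|n]; rewrite ?coeff_nil_letterwiseS ?coeffU.
Qed.

Lemma stuffle0l y : stuffle 0 y = 0.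
Proof. exact: linear0. Qed.

Lemma stuffleDl x y z : stuffle (x + y) z = stuffle x z + stuffle y z.
Proof. exact: linearD. Qed.

Lemma prependD a x y : prepend a (x + y) = prepend a x + prepend a y.
Proof. exact: linearD. Qed.

(** The derivation rule for a word times a letterwise sum, the form that the
divided powers of (1) have. *)
Lemma drop_one_stuffle w phi n : all (leq 1) w ->
  drop_one (stuffle << w >> (letterwise phi n)) =
    stuffle (drop_one << w >>) (letterwise phi n) +
    phi 1%N *: stuffle << w >> (letterwise_pred phi n).
Proof.
elim: w n => [|a w IHw] n.
  rewrite !stuffle1x drop_one_letterwise drop_one_wordE => _.
  by rewrite stuffle0l add0r.
move=> /= /andP[a_gt0 w_pos]; elim/ltn_ind: n => -[_|n IHn].
  by rewrite !stufflex1 linear0 scaler0 addr0.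
have coeff_w0 : coeff [::] (stuffle << w >> (letterwise phi n.+1)) = 0.
  case: (w) => [|b w']; last exact: coeff_nil_stuffle_cons.
  by rewrite stuffle1x coeff_nil_letterwiseS.
set c : rat := ((a == 1%N) && (w == [::]))%:R.
have dropW : drop_one << a :: w >> =
    prepend a (drop_one << w >>) + c *: << [::] >>.
  by rewrite !drop_one_wordE.
rewrite -[in LHS]prepend_word stuffle_prepend_letterwise drop_oneD drop_one_sum.
rewrite drop_one_prepend coeff_w0 mulr0 scale0r addr0 (IHw _ w_pos).
have dropWl m : stuffle (drop_one << a :: w >>) (letterwise phi m) =
    stuffle (prepend a (drop_one << w >>)) (letterwise phi m) +
    c *: letterwise phi m.
  by rewrite dropW stuffleDl stuffleZl stuffle1x.
rewrite dropWl [X in c *: X]letterwiseS [X in _ = X + _ + _]stuffle_prepend_letterwise.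
rewrite -[X in _ = _ + _ *: stuffle X _]prepend_word.
rewrite [X in _ = _ + _ *: X]stuffle_prepend_letterwise_pred.
rewrite !prepend_word prependD prependZ !scalerDr !scaler_sumr.
rewrite -!addrA; congr (_ + _); rewrite [RHS]addrC -!addrA [RHS]addrCA; congr (_ + _).
rewrite -!big_split /=.
apply: eq_bigr => -[i /= ilt] _.
rewrite drop_oneZ drop_oneD !drop_one_prepend coeff_nil_stuffle_cons.
rewrite (_ : (a + i.+1)%N == 1%N = false); last by lia.
rewrite mulr0 mul0r !scale0r !addr0 IHn; last by lia.
rewrite (IHw _ w_pos) dropWl !prependD !prependZ !scalerDr !scalerA.
rewrite (mulrC c) (mulrC (phi 1%N)).
by rewrite (AC (3*2) (2*((3*5)*(1*4)))).
Qed.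

Definition supported (P : pred (seq nat)) (x : Hstuffle) := all P (freeg.dom x).

Lemma supported0 P : supported P 0.
Proof. by rewrite /supported dom0. Qed.

Lemma supportedD P x y : supported P x -> supported P y -> supported P (x + y).
Proof.
move=> /allP Px /allP Py; apply/allP => k /domD_subset.
by rewrite mem_cat => /orP[/Px|/Py].
Qed.

Lemma supportedZ P c x : supported P x -> supported P (c *: x).
Proof. by move=> /allP Px; apply/allP => k /domZ_subset /Px. Qed.

Lemma supported_sum P I (r : seq I) (F : I -> Hstuffle) :
  (forall i, supported P (F i)) -> supported P (\sum_(i <- r) F i).
Proof.
by move=> PF; elim/big_ind: _ => //; [exact: supported0|exact: supportedD].
Qed.

Lemma supported_prepend (P Q : pred (seq nat)) a x :
  (forall k, P k -> Q (a :: k)) ->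
  supported P x -> supported Q (prepend a x).
Proof.
move=> PQ /allP Px; rewrite (word_expansion x) prepend_sum big_seq.
elim/big_ind: _ => [||k kx]; [exact: supported0|exact: supportedD|].
rewrite prependZ prepend_word; apply: supportedZ.
by rewrite /supported domU1 /= PQ // Px.
Qed.

Lemma supported_letterwise phi n : phi 1%N = 0 ->
  supported (all (leq 2)) (letterwise phi n).
Proof.
move=> phi1; elim/ltn_ind: n => -[_|n IHn].
  by rewrite letterwise0 /supported domU1.
rewrite letterwiseS; apply: supported_sum => i.
have [->|i_gt0] := posnP i; first by rewrite phi1 scale0r supported0.
apply: supportedZ; apply: supported_prepend (IHn _ _); last first.
  by rewrite ltnS leq_subr.
by move=> k /=; rewrite ltnS i_gt0.
Qed.

Lemma admissible_ge2 k : all (leq 2) k -> admissible k.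
Proof.
move=> k2; rewrite /admissible; apply/andP; split.
  by apply: sub_all k2 => i /ltnW.
by case: k k2 => // a k /allP k2; rewrite /= k2 // mem_last.
Qed.

Lemma drop_one_H0 x : in_H0 x -> drop_one x = 0.
Proof.
move=> /allP adm; rewrite {1}(word_expansion x) drop_one_sum big_seq.
rewrite big1 // => k /adm; rewrite drop_oneZ drop_one_wordE => k_adm.
suff -> : drop_one_word k = 0 by rewrite scaler0.
elim: k k_adm => // a [|b k] IHk /andP[/andP[a1 bk1] last2].
  have {}last2 : (1 < a)%N := last2.
  by rewrite /= (gtn_eqF last2) scale0r linear0 addr0.
rewrite -drop_one_wordE -prepend_word drop_one_prepend drop_one_wordE IHk.
  by rewrite linear0 coeffU !mulr0 scale0r addr0.
by apply/andP.
Qed.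

Lemma drop_one_H0_exp x l : in_H0 x ->
  drop_one (stuffle x (stuffle_exp << [:: 1%N] >> l.+1)) =
    stuffle x (stuffle_exp << [:: 1%N] >> l) *+ l.+1.
Proof.
move=> xH0.
have pos k : k \in freeg.dom x -> all (leq 1) k.
  by move/(allP xH0) => /andP[].
have exp1 : exp_series (1 : rat) 1 = 1 by rewrite /exp_series expr1n divr1.
rewrite !stuffle_exp_letterwise !raddfMn /= -mulrnA mulnC -factS; congr (_ *+ _).
transitivity (stuffle (drop_one x) (letterwise (exp_series 1) l.+1) +
  stuffle x (letterwise (exp_series 1) l)); last first.
  by rewrite drop_one_H0 // stuffle0l add0r.
rewrite (word_expansion x) !(stuffle_suml, drop_one_sum) -big_split.
rewrite big_seq [RHS]big_seq; apply: eq_bigr => k kx /=.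
rewrite !(drop_oneZ, stuffleZl) drop_one_stuffle ?pos //.
by rewrite exp1 scale1r scalerDr.
Qed.

(** A relation between powers of (1) over the admissible indices is trivial:
differentiate it with respect to (1) and use induction on the degree. *)
Lemma stuffle_exp_free n (u : nat -> Hstuffle) :
  (forall l, (l <= n)%N -> in_H0 (u l)) ->
  \sum_(l < n.+1) stuffle (u l) (stuffle_exp << [:: 1%N] >> l) = 0 ->
  forall l, (l <= n)%N -> u l = 0.
Proof.
elim: n u => [|n IHn] u uH0 usum.
  by case=> // _; move: usum; rewrite big_ord1 stufflex1.
have uS l : (l <= n)%N -> u l.+1 = 0.
  move=> lein; apply: (scalerI (a := l.+1%:R)); first by rewrite pnatr_eq0.
  rewrite scaler0.
  apply: (IHn (fun l => l.+1%:R *: u l.+1)) lein => [m lemn|].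
    by apply: supportedZ; exact: uH0.
  move/(congr1 drop_one): usum.
  rewrite big_ord_recl stufflex1 drop_oneD drop_one_H0 ?uH0 // add0r.
  rewrite drop_one_sum linear0 => usum'; rewrite -[RHS]usum'; apply: eq_bigr => i _.
  rewrite drop_one_H0_exp ?uH0 //; last exact: ltn_ord.
  by rewrite stuffleZl scaler_nat.
case=> [_|l]; last exact: uS.
move: usum; rewrite big_ord_recl stufflex1 big1 ?addr0 // => i _.
by rewrite (uS i (ltn_ord i)) stuffle0l.
Qed.

Lemma decomposition_unique k (u v : {ffun 'I_(size k).+1 -> Hstuffle}) :
  is_decomposition u -> is_decomposition v -> u = v.
Proof.
move=> [uH0 usum] [vH0 vsum].
pose w (l : nat) := u (inord l) - v (inord l).
have w0 := @stuffle_exp_free (size k) w _ _.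
apply/ffunP => l; apply/eqP; rewrite -subr_eq0; apply/eqP.
rewrite -(inord_val l); apply: w0; last by rewrite -ltnS.
  move=> m _; apply: supportedD (uH0 _) _.
  by rewrite -scaleN1r; apply: supportedZ; exact: vH0.
transitivity (<< k >> - << k >> : Hstuffle); last by rewrite subrr.
rewrite {1}usum vsum -sumrB; apply: eq_bigr => i _.
by rewrite /w !inord_val stuffleDl -scaleN1r stuffleZl scaleN1r.
Qed.

Lemma decompositionE k (u : {ffun 'I_(size k).+1 -> Hstuffle}) :
  is_decomposition u -> decomposition k = u.
Proof.
move=> uk; apply: decomposition_unique (uk).
exact: (xgetPex _ (ex_intro _ u uk)).
Qed.

(** The series [(1 + t) exp (- t)]. It has no linear term, so that its letterwise
sums are made of admissible words, and its product by [exp t] is [1 + t], whose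
letterwise sums are the words (1,...,1). *)
Definition reg_series : nat -> rat :=
  conv (linear_series 1) (exp_series (- 1)).

Lemma reg_series0 : reg_series 0 = 1.
Proof. by rewrite /reg_series conv0 exp_series0 mulr1. Qed.

Lemma reg_series1 : reg_series 1 = 0.
Proof.
by rewrite /reg_series conv_linearS exp_series0 /exp_series expr1 divr1 mulr1
  addNr.
Qed.

Lemma conv_reg_series n : conv reg_series (exp_series 1) n = linear_series 1 n.
Proof.
rewrite /reg_series -convA -[RHS]conv1s [RHS]convC.
apply: eq_conv => // i _; rewrite conv_exp addNr.
rewrite /exp_series /unit_series /linear_series.
case: i => [|i]; first by rewrite expr0 divr1.
by rewrite exprS !mul0r; case: i => [|i] //=; rewrite nth_nil.
Qed.

Lemma letterwise_linear n :
  letterwise (linear_series 1) n = << nseq n 1%N >>.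
Proof.
elim: n => [|n IHn] //; rewrite letterwiseS big_ord_recl subn0 scale1r IHn.
rewrite prepend_word big1 ?addr0 // => i _.
by rewrite /linear_series /= nth_nil scale0r.
Qed.

(** By multiplicativity of letterwise sums, (1,...,1) is the convolution of the
sums of [reg_series] with those of [exp t], which are the divided powers of (1). *)
Lemma decomposition_ones r :
  decomposition (nseq r 1%N) =
    [ffun l : 'I_(size (nseq r 1%N)).+1 =>
      l`!%:R^-1 *: letterwise reg_series (r - l)].
Proof.
apply: decompositionE; split=> [l|].
  rewrite ffunE; apply: supportedZ.
  have := supported_letterwise (r - l) reg_series1.
  exact/sub_all/admissible_ge2.
rewrite -letterwise_linear.
transitivity (letterwise (conv reg_series (exp_series 1)) r).
  by congr (letterwise _ r); apply/funext => n; rewrite conv_reg_series.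
rewrite -letterwise_conv ?reg_series0 ?exp_series0 // size_nseq.
rewrite (reindex_inj rev_ord_inj) /=; apply: eq_bigr => l _.
rewrite subSS ffunE stuffleZl stuffle_exp_letterwise raddfMn /=.
by rewrite subKn -1?ltnS // -scaler_nat scalerA mulVf ?scale1r //
  pnatr_eq0 -lt0n fact_gt0.
Qed.
(** * Nested sums *)

Section NestedSums.
Variable K : numFieldType.
Implicit Types (f : seq nat -> K) (x : nat -> K).

Definition extend f (y : Hstuffle) : K :=
  \sum_(k <- freeg.dom y) ratr (coeff k y) * f k.

Lemma extend_superset f (r : seq (seq nat)) y :
  uniq r -> {subset freeg.dom y <= r} ->
  extend f y = \sum_(k <- r) ratr (coeff k y) * f k.
Proof.
move=> r_uniq yr; rewrite [RHS](bigID (mem (freeg.dom y))) /=.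
rewrite [X in _ + X]big1 ?addr0 => [|k /coeff_outdom ->]; last first.
  by rewrite rmorph0 mul0r.
rewrite -[RHS]big_filter; apply: perm_big; apply: uniq_perm.
- exact: uniq_dom.
- exact: filter_uniq.
by move=> k; rewrite mem_filter; apply/idP/andP => [ky|[]//]; split=> //; exact: yr.
Qed.

Lemma extendD f y z : extend f (y + z) = extend f y + extend f z.
Proof.
pose r := undup (freeg.dom y ++ freeg.dom z).
have rE t : {subset freeg.dom t <= freeg.dom y ++ freeg.dom z} ->
    extend f t = \sum_(k <- r) ratr (coeff k t) * f k.
  move=> tr; apply: extend_superset; first exact: undup_uniq.
  by move=> k /tr; rewrite mem_undup.
rewrite !rE; first last.
- exact: domD_subset.
- by move=> k ky; rewrite mem_cat; apply/orP; left.
- by move=> k kz; rewrite mem_cat; apply/orP; right.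
by rewrite -big_split; apply: eq_bigr => k _; rewrite coeffD rmorphD mulrDl.
Qed.

Lemma extendZ f c y : extend f (c *: y) = ratr c * extend f y.
Proof.
rewrite (@extend_superset f (freeg.dom y)) ?uniq_dom //; last exact: domZ_subset.
rewrite mulr_sumr; apply: eq_bigr => k _.
by rewrite coeffZ rmorphM mulrA.
Qed.

Lemma extend_sum f I (r : seq I) (F : I -> Hstuffle) :
  extend f (\sum_(i <- r) F i) = \sum_(i <- r) extend f (F i).
Proof.
elim: r => [|i r IHr]; last by rewrite !big_cons extendD IHr.
by rewrite !big_nil /extend dom0 big_nil.
Qed.

Lemma extend_word f k : extend f << k >> = f k.
Proof. by rewrite /extend domU1 big_seq1 coeffU eqxx mulr1 rmorph1 mul1r. Qed.

Variables (x : nat -> K) (N : nat).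

Fixpoint nested (a : seq nat) (m : nat) : K :=
  if a is b :: w then \sum_(m.+1 <= n < N.+1) x n ^+ b * nested w n else 1.

Lemma nested_cons b w m : (m < N)%N ->
  nested (b :: w) m = x m.+1 ^+ b * nested w m.+1 + nested (b :: w) m.+1.
Proof. by move=> mN /=; rewrite big_ltn. Qed.

Lemma extend_nested_prepend b y m : (m < N)%N ->
  extend (nested^~ m) (prepend b y) =
    x m.+1 ^+ b * extend (nested^~ m.+1) y
    + extend (nested^~ m.+1) (prepend b y).
Proof.
move=> mN; rewrite (word_expansion y) prepend_sum !extend_sum mulr_sumr.
rewrite -big_split; apply: eq_bigr => k _.
rewrite prependZ prepend_word !extendZ !extend_word nested_cons //.
by rewrite mulrDr [_ * (x _ ^+ _ * _)]mulrCA.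
Qed.

Lemma nested_letterwise phi m n : phi 0%N = 1 -> (m < N)%N ->
  extend (nested^~ m) (letterwise phi n) =
    conv (fun a => x m.+1 ^+ a * ratr (phi a))
      (fun i => extend (nested^~ m.+1) (letterwise phi i)) n.
Proof.
move=> phi0 mN; case: n => [|n].
  by rewrite conv0 letterwise0 !extend_word phi0 rmorph1 !mulr1.
rewrite /conv big_ord_recl phi0 rmorph1 !mul1r subn0.
rewrite {1 2}letterwiseS !extend_sum addrC -big_split; apply: eq_bigr => i _ /=.
rewrite !extendZ extend_nested_prepend // mulrDr /bump /= subSS; congr (_ + _).
by ring.
Qed.

(** Splitting off the summation variable [x m.+1] multiplies by the series of
the [phi a * x m.+1 ^+ a]: nested sums turn a letterwise sum into a product over
the variables, and the logarithmic derivatives of the factors add up. *)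
Lemma log_deriv_nested phi q m : log_deriv phi q -> (m <= N)%N ->
  log_deriv (fun n => extend (nested^~ m) (letterwise phi n))
    (fun i => ratr (q i) * \sum_(m.+1 <= n < N.+1) x n ^+ i.+1).
Proof.
move=> phiq mN; rewrite -(subKn mN); have := leq_subr m N.
elim: (N - m)%N => [_|d IHd dN].
  rewrite subn0.
  have -> : (fun n => extend (nested^~ N) (letterwise phi n)) = unit_series K.
    apply/funext => -[|n]; first by rewrite letterwise0 extend_word.
    rewrite letterwiseS extend_sum big1 => [|i _].
      by case: n => [|n] //; rewrite /unit_series /linear_series /= nth_nil.
    rewrite extendZ (word_expansion (letterwise _ _)) prepend_sum extend_sum.
    rewrite big1 ?mulr0 // => k _.
    by rewrite prependZ prepend_word extendZ extend_word /= big_geq // mulr0.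
  have -> : (fun i => ratr (q i) * \sum_(N.+1 <= n < N.+1) x n ^+ i.+1) = fun=> 0.
    by apply/funext => i; rewrite big_geq // mulr0.
  exact: log_deriv_unit.
have mE : (N - d)%N = (N - d.+1).+1 by lia.
have ltmN : (N - d.+1 < N)%N by lia.
have {IHd} := IHd (ltnW dN); rewrite mE; move: ltmN; move: (N - d.+1)%N => {mE}m' ltmN.
have [phi0 _] := phiq.
move/(log_deriv_conv (log_deriv_scale (x m'.+1) (log_deriv_map (@ratr K) phiq))).
congr log_deriv; apply/funext => n; first by rewrite nested_letterwise.
by rewrite /= [in RHS]big_ltn // mulrDr mulrC.
Qed.

End NestedSums.
(** * Complex limits *)

Section ComplexLimits.
Variable R : realType.
Implicit Types (z : CC R) (u v : nat -> CC R) (g : nat -> R).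

Definition toC (x : R) : CC R := (x%:C)%C.

Lemma toCD x y : toC (x + y) = toC x + toC y. Proof. exact: rmorphD. Qed.
Lemma toCM x y : toC (x * y) = toC x * toC y. Proof. exact: rmorphM. Qed.
Lemma toCN x : toC (- x) = - toC x. Proof. exact: rmorphN. Qed.
Lemma toCX x n : toC (x ^+ n) = toC x ^+ n. Proof. exact: rmorphXn. Qed.
Lemma toCV x : toC x^-1 = (toC x)^-1. Proof. exact: fmorphV. Qed.
Lemma toC_nat n : toC n%:R = n%:R. Proof. exact: rmorph_nat. Qed.
Lemma toC0 : toC 0 = 0. Proof. by []. Qed.
Lemma toC1 : toC 1 = 1. Proof. by []. Qed.

Lemma toC_sum I (r : seq I) (F : I -> R) :
  toC (\sum_(i <- r) F i) = \sum_(i <- r) toC (F i).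
Proof. exact: rmorph_sum. Qed.

Lemma ler_toC x y : (toC x <= toC y) = (x <= y). Proof. exact: lecR. Qed.
Lemma ltr_toC x y : (toC x < toC y) = (x < y). Proof. exact: ltcR. Qed.

Definition realpart z : R := complex.Re z.
Definition imagpart z : R := complex.Im z.

Definition modulus z : R := complex.Re `|z|.

Lemma modulusE z : `|z| = toC (modulus z).
Proof. by rewrite /modulus /toC normc_def. Qed.

Lemma modulus_ge0 z : 0 <= modulus z.
Proof. by rewrite -ler_toC -modulusE normr_ge0. Qed.

Lemma norm_toC x : `|toC x| = toC `|x|.
Proof. by rewrite /toC normc_def /= expr0n addr0 sqrtr_sqr. Qed.

Lemma gt0_toC (e : CC R) : 0 < e -> {d : R | 0 < d & e = toC d}.
Proof.
move=> e0; exists (complex.Re e); first by move: e0; rewrite ltcE /= => /andP[].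
by rewrite /toC RRe_real // realE ltW.
Qed.

Lemma cvg_modulus u z :
  (forall e : R, 0 < e -> \forall n \near \oo, `|u n - z| <= toC e) ->
  u @ \oo --> z.
Proof.
move=> uz; apply/cvgrPdist_le => e /gt0_toC[d d0 ->].
by near=> n; rewrite distrC; near: n; exact: uz.
Unshelve. all: by end_near. Qed.

Lemma cvg_modulus_inv u z (e : R) : u @ \oo --> z -> 0 < e ->
  \forall n \near \oo, `|u n - z| <= toC e.
Proof.
move=> /cvgrPdist_le uz e0; near=> n; rewrite distrC; near: n.
by apply: uz; rewrite -toC0 ltr_toC.
Unshelve. all: by end_near. Qed.

Lemma cvg_bound u z g : (\forall n \near \oo, `|u n - z| <= toC (g n)) ->
  g @ \oo --> (0 : R) -> u @ \oo --> z.
Proof.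
move=> ug /cvgrPdist_le g0; apply: cvg_modulus => e e0.
near=> n; apply: (@le_trans _ _ (toC (g n))); first by near: n.
rewrite ler_toC; apply: le_trans (ler_norm _) _.
by rewrite -[`|_|]normrN -sub0r; near: n; exact: g0.
Unshelve. all: by end_near. Qed.

Lemma cvg_toC g (x : R) : g @ \oo --> x -> (toC \o g) @ \oo --> toC x.
Proof.
move=> /cvgrPdist_le gx; apply: cvg_modulus => e e0.
near=> n; rewrite /= -toCN -toCD norm_toC ler_toC distrC.
by near: n; exact: gx.
Unshelve. all: by end_near. Qed.

Lemma cvg_complex (g h : nat -> R) (x y : R) :
  g @ \oo --> x -> h @ \oo --> y ->
  (fun n => toC (g n) + Ci * toC (h n)) @ \oo --> toC x + Ci * toC y.
Proof.
by move=> gx hy; apply: cvgD; [exact: cvg_toC|apply: cvgMr; exact: cvg_toC].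
Qed.

Lemma CiE z : z = toC (realpart z) + Ci * toC (imagpart z).
Proof. exact: complexE. Qed.

Lemma Ci_sqr : (Ci : CC R) ^+ 2 = -1.
Proof. exact: sqr_i. Qed.

Lemma Re_le z : toC `|realpart z| <= `|z|.
Proof. exact: normc_ge_Re. Qed.

Lemma Im_le z : toC `|imagpart z| <= `|z|.
Proof.
rewrite /toC normc_def lecR -sqrtr_sqr; apply: ler_wsqrtr.
by rewrite lerDr sqr_ge0.
Qed.

Lemma series_abs_cvg u g : (forall n, `|u n| <= toC (g n)) ->
  cvgn (series g) -> cvgn (series u).
Proof.
move=> ug cg.
have part (f : CC R -> R) : (forall z, toC `|f z| <= `|z|) ->
    cvgn (series (f \o u)).
  move=> fle; apply: normed_cvg; apply: series_le_cvg cg => n //=.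
    by rewrite -ler_toC toC0 (le_trans _ (ug n)) // normr_ge0.
  by rewrite -ler_toC (le_trans (fle _) (ug n)).
have uE : series u = fun n => toC (series (realpart \o u) n)
    + Ci * toC (series (imagpart \o u) n).
  apply/funext => n; rewrite /series /= !toC_sum mulr_sumr -big_split.
  by apply: eq_bigr => i _; exact: CiE.
rewrite uE; apply: cvgP; apply: cvg_complex.
  exact: part Re_le.
exact: part Im_le.
Qed.

Lemma cvg_norm_le u z (b : R) : u @ \oo --> z ->
  (\forall n \near \oo, `|u n| <= toC b) -> `|z| <= toC b.
Proof.
move=> uz ub; apply/ler_addgt0Pr => e /gt0_toC[d d0 ->].
have [n [un1 un2]] : exists n, `|u n - z| <= toC d /\ `|u n| <= toC b.
  near \oo => n; exists n; split; last by near: n.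
  by near: n; exact: cvg_modulus_inv.
rewrite -[z](subKr (u n)).
by apply: le_trans (ler_normB _ _) (lerD _ _).
Unshelve. all: by end_near. Qed.

Lemma cvg_finsum (I : eqType) (r : seq I) (f : nat -> I -> CC R) (l : I -> CC R) :
  {in r, forall k, (fun n => f n k) @ \oo --> l k} ->
  (fun n => \sum_(k <- r) f n k) @ \oo --> \sum_(k <- r) l k.
Proof.
elim: r => [|k r IHr] fl.
  rewrite big_nil [X in X @ _](_ : _ = fun=> 0); first exact: cvg_cst.
  by apply/funext => n; rewrite big_nil.
rewrite big_cons [X in X @ _](_ : _ = fun n => f n k + \sum_(j <- r) f n j).
  apply: (cvgD (fl k (mem_head _ _)) (IHr _)) => j jr.
  by apply: fl; rewrite inE jr orbT.
by apply/funext => n; rewrite big_cons.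
Qed.

Lemma cvg_const_mul u z w : u @ \oo --> z -> (fun n => w * u n) @ \oo --> w * z.
Proof. by move=> uz; exact: (cvgMl_tmp uz). Qed.

Lemma cvg_exp u z m : u @ \oo --> z -> (fun n => u n ^+ m) @ \oo --> z ^+ m.
Proof.
move=> uz; elim: m => [|m IHm]; first exact: cvg_cst.
have -> : (fun n => u n ^+ m.+1) = u \* (fun n => u n ^+ m).
  by apply/funext => n; rewrite exprS.
by rewrite exprS; exact: (cvgM uz IHm).
Qed.

(** Tannery's theorem for terms that tend to 0: beyond a fixed index the sum is
uniformly small by domination, and before it there are finitely many terms. *)
Lemma tannery0 (a : nat -> nat -> CC R) g (N0 K0 : nat) :
  cvgn (series g) ->
  (forall N k, (N0 <= N)%N -> (K0 <= k < N)%N -> `|a N k| <= toC (g k)) ->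
  (forall k, (fun N => a N k) @ \oo --> (0 : CC R)) ->
  (fun N => \sum_(0 <= k < N) a N k) @ \oo --> (0 : CC R).
Proof.
move=> cg ag a0; apply: cvg_modulus => e e0.
have /cauchy_cvgP/cauchy_seriesP/(_ (e / 2)) := cg.
rewrite divr_gt0 // => /(_ isT)[[A B] /= [[nA _ nA'] [nB _ nB']] AB].
pose K := maxn K0 (maxn nA nB).
have small N : (N0 <= N)%N -> (K <= N)%N ->
    `|\sum_(K <= k < N) a N k| <= toC (e / 2).
  move=> N0N KN; apply: le_trans (ler_norm_sum _ _ _) _.
  apply: (@le_trans _ _ (toC (\sum_(K <= k < N) g k))).
    rewrite toC_sum big_nat [leRHS]big_nat; apply: ler_sum => k /andP[Kk kN].
    by apply: ag => //; rewrite kN andbT (leq_trans _ Kk) // leq_maxl.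
  rewrite ler_toC; apply: le_trans (ler_norm _) _; apply: ltW; apply: (AB (K, N)).
  by split=> /=; [apply: nA' => /=|apply: nB' => /=]; rewrite /K; lia.
have head0 : (fun N => \sum_(0 <= k < K) a N k) @ \oo --> (0 : CC R).
  rewrite [X in _ --> X](_ : _ = \sum_(0 <= k < K) (0 : CC R)).
    by apply: (@cvg_finsum _ _ a (fun=> 0)) => k _; exact: a0.
  by rewrite big1.
have := cvg_modulus_inv head0 (_ : 0 < e / 2).
rewrite divr_gt0 // => /(_ isT) head_small.
near=> N; have KN : (K <= N)%N by near: N; exact: nbhs_infty_ge.
rewrite subr0 (big_cat_nat (leq0n K) KN) /=.
rewrite (splitr e) toCD; apply: le_trans (ler_normD _ _) (lerD _ _).
  by rewrite -[X in `|X|]subr0; near: N.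
by apply: small => //; near: N; exact: nbhs_infty_ge.
Unshelve. all: by end_near. Qed.

Lemma tannery (a : nat -> nat -> CC R) (l : nat -> CC R) g (N0 K0 : nat) (L : CC R) :
  cvgn (series g) ->
  (forall N k, (N0 <= N)%N -> (K0 <= k < N)%N -> `|a N k| <= toC (g k)) ->
  (forall k, (fun N => a N k) @ \oo --> l k) ->
  series l @ \oo --> L ->
  (fun N => \sum_(0 <= k < N) a N k) @ \oo --> L.
Proof.
move=> cg ag al lL.
have lg k : (K0 <= k)%N -> `|l k| <= toC (g k).
  move=> K0k; apply: cvg_norm_le (al k) _.
  exists (maxn N0 k.+1) => // N /=; rewrite geq_max => /andP[? ?].
  by apply: ag => //; lia.
have : (fun N => \sum_(0 <= k < N) (a N k - l k)) @ \oo --> (0 : CC R).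
  apply: (@tannery0 _ (fun k => 2 * g k) N0 K0).
  - have -> : (fun k => 2 * g k) = 2 *: g by [].
    exact: is_cvg_seriesZ.
  - move=> N k N0N K0k; apply: le_trans (ler_normB _ _) _.
    rewrite toCM toC_nat mulr_natl mulr2n; apply: lerD; first exact: ag.
    by apply: lg; case/andP: K0k.
  - move=> k; rewrite -[X in _ --> X](subrr (l k)).
    exact: (cvgB (al k) (cvg_cst (l k))).
have -> : (fun N => \sum_(0 <= k < N) a N k) =
    (fun N => \sum_(0 <= k < N) (a N k - l k)) \+ series l.
  apply/funext => N; rewrite /= /series -big_split.
  by apply: eq_bigr => k _; rewrite /= subrK.
by move=> al0; rewrite -[L]add0r; exact: (cvgD al0 lL).
Qed.

(** Mertens' theorem: the partial sums of the Cauchy product are the sums of the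
[u k * V (N - k)], with [V] the bounded partial sums of [v]; let [N] tend to
infinity termwise. *)
Lemma mertens u v g (A B : CC R) :
  (forall n, `|u n| <= toC (g n)) -> cvgn (series g) ->
  series u @ \oo --> A -> series v @ \oo --> B ->
  series (conv u v) @ \oo --> A * B.
Proof.
move=> ug cg uA vB.
have [M M0 Mv] : exists2 M : R, 0 < M & forall n, `|series v n| <= toC M.
  have /cvg_seq_bounded/pinfty_ex_gt0[c c0 cv] : cvgn (series v) by apply: cvgP vB.
  by have [M M0 cM] := gt0_toC c0; exists M => // n; rewrite -cM; exact: cv.
have -> : series (conv u v) =
    fun N => \sum_(0 <= k < N) u k * series v (N - k)%N.
  apply/funext => -[|N]; first by rewrite /series /= !big_geq.
  rewrite /series /= !big_mkord.
  rewrite -[LHS]/(sum2 N (fun i _ => sum2 i (fun a b => u a * v b))).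
  rewrite (sum2A N (fun a b _ => u a * v b)); apply: eq_bigr => a _.
  by rewrite /sum2 -mulr_sumr subSn -1?ltnS // big_mkord.
apply: (@tannery _ (fun k => u k * B) (fun k => M * g k) 0 0).
- have -> : (fun k => M * g k) = M *: g by [].
  exact: is_cvg_seriesZ.
- move=> N k _ _; rewrite normrM toCM mulrC.
  by apply: ler_pM => //; rewrite normr_ge0.
- move=> k; apply: cvgMl_tmp; apply: cvg_modulus => e e0.
  have [N1 _ H] := cvg_modulus_inv vB e0.
  by exists (N1 + k)%N => // N /= leN; apply: H; rewrite /= leq_subRL; lia.
have -> : series (fun k => u k * B) = fun n => series u n * B.
  by apply/funext => n; rewrite /series /= mulr_suml.
exact: (cvgMr_tmp uA).
Qed.

(** * The complex exponential *)

Lemma series_expR (x : R) : series (exp_series x) @ \oo --> expR x.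
Proof. exact: is_cvg_series_exp_coeff. Qed.

Lemma exp_series_Ci (y : R) n :
  exp_series (Ci * toC y) n = toC (cos_coeff y n) + Ci * toC (sin_coeff y n).
Proof.
rewrite /exp_series /cos_coeff /sin_coeff /= !toCM !toCX !toCV !toC_nat toCN toC1.
have CiX m : (Ci : CC R) ^+ m =
    (~~ odd m)%:R * (-1) ^+ m./2 + Ci * ((odd m)%:R * (-1) ^+ m.-1./2).
  rewrite -{1}(odd_double_half m) exprD -mul2n exprM Ci_sqr.
  case: (boolP (odd m)) => om /=; last by rewrite expr0; ring.
  have -> : (m.-1./2 = m./2)%N by case: m om => //= m; rewrite uphalf_half => /negbTE->.
  by rewrite expr1; ring.
by rewrite exprMn CiX; ring.
Qed.

(** The real part of the argument gives the real exponential series, the imaginary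
part gives the cosine and sine series, and the Cauchy product joins them. *)
Lemma cvg_exp_series z : series (exp_series z) @ \oo --> Cexp z.
Proof.
pose x := realpart z; pose y := imagpart z.
have zE : z = toC x + Ci * toC y by exact: CiE.
have toC_series (g : nat -> R) : toC \o series g = series (toC \o g).
  by apply/funext => n; rewrite /series /= toC_sum.
have expE (t : R) : toC \o exp_series t = exp_series (toC t).
  by apply/funext => n; rewrite /exp_series /= toCM toCX toCV toC_nat.
have -> : Cexp z = toC (expR x) * (toC (cos y) + Ci * toC (sin y)).
  rewrite /Cexp /x /y; case: (z) => a b.
  by rewrite /toC /Ci /=; simpc.
have -> : exp_series z = conv (exp_series (toC x)) (exp_series (Ci * toC y)).
  by apply/funext => n; rewrite conv_exp -zE.
apply: (@mertens _ _ (exp_series `|x|)).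
- move=> n; rewrite -expE /= norm_toC /exp_series normrM normrX normfV.
  by rewrite normr_nat.
- by apply: cvgP; exact: series_expR.
- by rewrite -expE -toC_series; apply: cvg_toC; exact: series_expR.
have -> : series (exp_series (Ci * toC y)) =
    fun n => toC (series (cos_coeff y) n) + Ci * toC (series (sin_coeff y) n).
  apply/funext => n; rewrite /series /= !toC_sum mulr_sumr -big_split.
  by apply: eq_bigr => i _; exact: exp_series_Ci.
apply: cvg_complex.
  by rewrite cos.unlock; exact: is_cvg_series_cos_coeff.
by rewrite sin.unlock; exact: is_cvg_series_sin_coeff.
Qed.

Lemma CexpD z w : Cexp (z + w) = Cexp z * Cexp w.
Proof.
case: z w => [a b] [c d]; rewrite /Cexp /= expRD cosD sinD.
by apply/eqP; rewrite eq_complex /=; apply/andP; split; apply/eqP; ring.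
Qed.

Lemma Cexp0 : Cexp (0 : CC R) = 1.
Proof. by rewrite /Cexp /= expR0 cos0 sin0 mul1r mulr0. Qed.

Lemma CexpM_nat z n : Cexp (n%:R * z) = Cexp z ^+ n.
Proof.
elim: n => [|n IHn]; first by rewrite mul0r Cexp0.
by rewrite exprS -IHn -CexpD -{2}[z]mul1r -mulrDl -nat1r.
Qed.

Lemma Cexp_neq0 z : Cexp z != 0.
Proof.
apply: contra_eq_neq (Cexp0) => z0.
by rewrite -(subrr z) CexpD z0 mul0r eq_sym oner_eq0.
Qed.

Lemma CexpN z : Cexp (- z) = (Cexp z)^-1.
Proof.
by apply: (mulfI (Cexp_neq0 z)); rewrite -CexpD subrr Cexp0 mulfV // Cexp_neq0.
Qed.

Lemma Cexp_taylor z :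
  `|Cexp z - 1 - z| <= toC (modulus z ^+ 2 * expR (modulus z)).
Proof.
pose tail N := series (exp_series z) N.+2 - 1 - z.
have tailE N : tail N = \sum_(0 <= k < N) exp_series z k.+2.
  rewrite /tail /series /= big_ltn // big_ltn // exp_series0.
  have -> : exp_series z 1 = z by rewrite /exp_series expr1 divr1.
  rewrite (_ : forall S, 1 + (z + S) - 1 - z = S); last by move=> S; ring.
  by rewrite !big_add1.
apply: (@cvg_norm_le tail).
  have sz : (fun N => series (exp_series z) N.+2) @ \oo --> Cexp z.
    by rewrite (cvg_shiftS (fun N => series (exp_series z) N.+1)) cvg_shiftS;
      exact: cvg_exp_series.
  have t := cvgB (cvgB sz (cvg_cst (1 : CC R))) (cvg_cst z).
  exact: t.
apply: nearW => N; rewrite tailE; apply: le_trans (ler_norm_sum _ _ _) _.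
apply: (@le_trans _ _ (toC (modulus z ^+ 2 *
    series (exp_series (modulus z)) N))).
  rewrite /series /= mulr_sumr toC_sum; apply: ler_sum => k _.
  rewrite normrM normrX normfV normr_nat modulusE -toCX -toC_nat -toCV -toCM.
  rewrite ler_toC -addn2 exprD [_ ^+ k * _]mulrC -mulrA addn2.
  apply: ler_wpM2l; first exact: exprn_ge0 (modulus_ge0 _).
  apply: ler_wpM2l; first exact: exprn_ge0 (modulus_ge0 _).
  rewrite lef_pV2 ?posrE ?ltr0n ?fact_gt0 // ler_nat.
  by rewrite !factS mulnA leq_pmull.
rewrite ler_toC; apply: ler_wpM2l; first exact: exprn_ge0 (modulus_ge0 _).
rewrite -(cvg_lim (@Rhausdorff R) (@series_expR (modulus z))).
apply: nondecreasing_cvgn_le; last by apply: cvgP; exact: series_expR.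
apply: nondecreasing_series => n _ _.
by rewrite divr_ge0 // exprn_ge0 // modulus_ge0.
Qed.

Lemma cvg_Cexp_near0 z :
  (fun n => n.+1%:R * (Cexp (z / n.+1%:R) - 1)) @ \oo --> z.
Proof.
pose M := modulus z ^+ 2 * expR (modulus z).
apply: (@cvg_bound _ _ (fun n => M * n.+1%:R^-1)); last first.
  by rewrite -[X in _ --> X](mulr0 M); apply: cvgMl_tmp; exact: cvg_harmonic.
apply: nearW => n.
have n0 : n.+1%:R != 0 :> CC R by rewrite pnatr_eq0.
have -> : n.+1%:R * (Cexp (z / n.+1%:R) - 1) - z =
    n.+1%:R * (Cexp (z / n.+1%:R) - 1 - z / n.+1%:R).
  by rewrite [RHS]mulrBr [_ * (z / _)]mulrC divfK.
rewrite normrM normr_nat.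
have modE : modulus (z / n.+1%:R) = modulus z / n.+1%:R.
  apply/eqP; rewrite eq_le -!ler_toC toCM toCV toC_nat -!modulusE normrM normfV.
  by rewrite normr_nat lexx.
apply: le_trans (ler_wpM2l _ (Cexp_taylor _)) _; first exact: ler0n.
rewrite modE -toC_nat -toCM ler_toC /M.
have -> : n.+1%:R * ((modulus z / n.+1%:R) ^+ 2 * expR (modulus z / n.+1%:R)) =
   modulus z ^+ 2 * expR (modulus z / n.+1%:R) * n.+1%:R^-1.
  have : n.+1%:R != 0 :> R by rewrite pnatr_eq0.
  by move: (expR _) => t b0; field.
apply: ler_wpM2r; first by rewrite invr_ge0.
apply: ler_wpM2l; first exact: exprn_ge0 (modulus_ge0 _).
rewrite ler_expR ler_pdivrMr // ler_peMr ?modulus_ge0 //.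
by rewrite ler1n.
Qed.

End ComplexLimits.
(** * The regularized values at the indices (1,...,1) *)

Section RegularizedValues.
Variable R : realType.
Implicit Types (s X z : CC R) (a : seq nat).

Lemma log_deriv_lim (f q : nat -> nat -> CC R) (F Q : nat -> CC R) :
  (forall N, log_deriv (f N) (q N)) ->
  (forall n, (fun N => f N n) @ \oo --> F n) ->
  (forall n, (fun N => q N n) @ \oo --> Q n) -> log_deriv F Q.
Proof.
move=> fq fF qQ; split=> [|n].
  have := fF 0%N; rewrite (_ : (fun N => f N 0%N) = fun=> 1).
    by move=> /(cvg_unique (@norm_hausdorff _ _)); apply; exact: cvg_cst.
  by apply/funext => N; have [] := fq N.
have lhs : (fun N => f N n.+1 * n.+1%:R) @ \oo --> F n.+1 * n.+1%:R.
  exact: (cvgMr_tmp (fF n.+1)).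
rewrite -[LHS]mulr_natr; apply: (cvg_unique (@norm_hausdorff _ _) lhs).
have -> : (fun N => f N n.+1 * n.+1%:R) =
    fun N => \sum_(i < n.+1) q N i * f N (n - i)%N.
  by apply/funext => N; rewrite mulr_natr; have [_ ->] := fq N.
by apply: cvg_finsum => i _; exact: (cvgM (qQ i) (fF _)).
Qed.

Definition inv_square (n : nat) : R := (n.+1%:R ^+ 2)^-1.

Lemma inv_square_ge0 n : 0 <= inv_square n.
Proof. by rewrite invr_ge0 exprn_ge0. Qed.

Lemma inv_square_sum_le2 n : series inv_square n <= 2.
Proof.
(* This bound, unlike 2, passes through the induction. *)
suff h : series inv_square n.+1 <= 2 - n.+1%:R^-1.
  apply: (@le_trans _ _ (series inv_square n.+1)).
    by rewrite seriesSr lerDl inv_square_ge0.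
  by apply: le_trans h _; rewrite gerDl oppr_le0 invr_ge0.
elim: n => [|n IHn].
  by rewrite /series /= big_nat1 /inv_square expr1n invr1; lra.
rewrite seriesSr; apply: le_trans (lerD IHn (lexx _)) _.
rewrite -addrA lerD2l /inv_square -[n.+2]addn1 natrD.
have : 0 < n.+1%:R :> R by rewrite ltr0n.
move: (n.+1%:R : R) => t t0; rewrite -subr_ge0.
have -> : - (t + 1)^-1 - (- t^-1 + ((t + 1) ^+ 2)^-1) = t^-1 / (t + 1) ^+ 2.
  by field; apply/andP; split; lra.
by rewrite divr_ge0 ?invr_ge0 ?exprn_ge0 //; lra.
Qed.

Lemma cvg_inv_square : cvgn (series inv_square).
Proof.
apply: nondecreasing_is_cvgn.
  by apply: nondecreasing_series => n _ _; exact: inv_square_ge0.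
by exists 2 => _ [n _ <-]; exact: inv_square_sum_le2.
Qed.

(** For [n >= 2 |z|] the modulus of [n + z] is at least [n / 2]; the constant [A]
absorbs the finitely many other terms. *)
Lemma inv_shift_bound z : exists2 A : R, 0 <= A &
  forall n, `|(n.+1%:R + z)^-1| <= toC (A / n.+1%:R).
Proof.
pose N := (Num.truncn (2 * modulus z)).+1.
have zN n : (N <= n.+1)%N -> 2 * modulus z <= n.+1%:R.
  move=> leN; apply: le_trans (ltW (truncnS_gt _)) _.
  by rewrite ler_nat.
pose w (k : nat) := modulus (k.+1%:R + z)^-1 * k.+1%:R.
have w_ge0 k : 0 <= w k by rewrite mulr_ge0 // modulus_ge0.
have sum_ge0 : 0 <= \sum_(0 <= k < N) w k by apply: sumr_ge0 => k _; exact: w_ge0.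
exists (2 + \sum_(0 <= k < N) w k); first by rewrite addr_ge0.
move=> n; have n_gt0 : 0 < n.+1%:R :> R by rewrite ltr0n.
have [leN|ltN] := leqP N n.+1.
  apply: (@le_trans _ _ (toC (2 / n.+1%:R))); last first.
    rewrite ler_toC; apply: ler_wpM2r; first by rewrite invr_ge0 ltW.
    by rewrite lerDl.
  rewrite normfV -[2 / _]invrK invf_div toCV.
  have half_gt0 : 0 < toC (n.+1%:R / 2 : R).
    by rewrite (ltr_toC 0) divr_gt0.
  have half_le : toC (n.+1%:R / 2) <= `|n.+1%:R + z|.
    apply: le_trans (lerB_normD _ _); rewrite normr_nat modulusE -(@toC_nat R) -toCN.
    by rewrite -toCD ler_toC; have := zN n leN; lra.
  by rewrite lef_pV2 ?posrE // (lt_le_trans half_gt0 half_le).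
rewrite modulusE ler_toC ler_pdivlMr // -/(w n).
rewrite (bigD1_seq n) ?iota_uniq ?mem_index_iota /= ?(ltnW ltN) //.
rewrite addrCA lerDl addr_ge0 //; apply: sumr_ge0 => k _; exact: w_ge0.
Qed.

Section Convergence.
Variables (x : nat -> CC R) (A : R).
Hypothesis (A_ge0 : 0 <= A) (x_le : forall n, `|x n.+1| <= toC (A / n.+1%:R)).

Lemma expr_le_inv_square b n : (2 <= b)%N ->
  `|x n.+1 ^+ b| <= toC (A ^+ b * inv_square n).
Proof.
move=> b2; rewrite normrX.
have inv_pow_le : n.+1%:R^-1 ^+ b <= inv_square n.
  rewrite /inv_square -exprVn; apply: ler_wiXn2l => //.
  by rewrite invf_le1 ?ltr0n // ler1n.
apply: (@le_trans _ _ (toC (A / n.+1%:R) ^+ b)); last first.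
  by rewrite -toCX ler_toC exprMn; apply: ler_wpM2l; [exact: exprn_ge0|exact: inv_pow_le].
by apply: lerXn2r => //; rewrite nnegrE ?normr_ge0 // (le_trans (normr_ge0 _) (x_le n)).
Qed.
Lemma cvg_power_sum b : (2 <= b)%N -> cvgn (series (fun n => x n.+1 ^+ b)).
Proof.
move=> b2; apply: (@series_abs_cvg _ _ (A ^+ b *: (inv_square : nat -> R))).
  by move=> n; exact: expr_le_inv_square.
by apply: is_cvg_seriesZ; exact: cvg_inv_square.
Qed.

Lemma norm_nested_diag N w : `|nested x N w N| <= 1.
Proof. by case: w => [|b w] /=; rewrite ?normr1 // big_geq // normr0. Qed.

(** Passing from [N] to [N + 1] only adds terms whose last variable is [x N.+1],
which occurs with an exponent at least 2. *)
Lemma nested_increment a : all (leq 2) a ->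
  exists2 C : R, 0 <= C & forall m N,
    `|nested x N.+1 a m - nested x N a m| <= toC (C * inv_square N).
Proof.
elim: a => [_|b w IHw /= /andP[b2 /IHw[C C_ge0 Cw]]].
  by exists 0 => // m N; rewrite subrr normr0 mul0r.
have Ab_ge0 : 0 <= A ^+ b by exact: exprn_ge0.
exists (A ^+ b * 2 * C + A ^+ b).
  by rewrite addr_ge0 // mulr_ge0 // mulr_ge0.
move=> m N; have [ltNm|lemN] := ltnP N m.
  rewrite /= !big_geq ?subrr ?normr0; [|by lia|by lia].
  rewrite (ler_toC 0) mulr_ge0 ?inv_square_ge0 //.
  by rewrite addr_ge0 // mulr_ge0 // mulr_ge0.
have -> : nested x N.+1 (b :: w) m - nested x N (b :: w) m =
    \sum_(m.+1 <= n < N.+1) x n ^+ b * (nested x N.+1 w n - nested x N w n)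
    + x N.+1 ^+ b * nested x N.+1 w N.+1.
  rewrite /= big_nat_recr //= addrAC -sumrB; congr (_ + _).
  by apply: eq_bigr => n _; rewrite mulrBr.
rewrite mulrDl toCD; apply: le_trans (ler_normD _ _) (lerD _ _).
  apply: le_trans (ler_norm_sum _ _ _) _; rewrite big_add1 /=.
  apply: (@le_trans _ _ (toC (\sum_(m <= n < N)
      A ^+ b * inv_square n * (C * inv_square N)))).
    rewrite toC_sum; apply: ler_sum => n _; rewrite normrM toCM.
    by apply: ler_pM => //; exact: expr_le_inv_square.
  rewrite ler_toC -mulr_suml mulrA; apply: ler_wpM2r; first exact: inv_square_ge0.
  apply: ler_wpM2r => //; rewrite -mulr_sumr; apply: ler_wpM2l => //.
  apply: le_trans (inv_square_sum_le2 N).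
  rewrite /series /= (big_cat_nat (leq0n m) lemN) /= lerDr.
  by apply: sumr_ge0 => k _; exact: inv_square_ge0.
rewrite normrM -[leRHS]mulr1; apply: ler_pM => //.
  exact: expr_le_inv_square.
exact: norm_nested_diag.
Qed.

Lemma cvg_nested a : all (leq 2) a -> cvgn (fun N => nested x N a 0).
Proof.
move=> /nested_increment[C C_ge0 Ca].
have -> : (fun N => nested x N a 0) = fun N => nested x 0 a 0 +
    series (fun N => nested x N.+1 a 0 - nested x N a 0) N.
  by apply/funext => N; rewrite /series /= telescope_sumr // addrC subrK.
apply: is_cvgD; first exact: is_cvg_cst.
apply: (@series_abs_cvg _ _ (C *: (inv_square : nat -> R))).
  by move=> N; exact: Ca.
by apply: is_cvg_seriesZ; exact: cvg_inv_square.
Qed.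

End Convergence.

Lemma zeta_partial_nested a s N :
  zeta_partial a s N = nested (fun n => (n%:R + s)^-1) N a 0.
Proof.
rewrite /zeta_partial; elim: a {1 3}0%N => [|b a IHa] m.
  rewrite (big_pred1 [tuple]) ?big_ord0 // => t.
  by rewrite [t]tuple0 /= eqxx.
pose cons_tuple (p : 'I_N.+1 * (size a).-tuple 'I_N.+1) := [tuple of p.1 :: p.2].
rewrite (reindex cons_tuple) /=; last first.
  exists (fun t => (thead t, [tuple of behead t])) => [[i t] _|t _] /=.
    by rewrite theadE; congr (_, _); apply: val_inj.
  by rewrite [RHS]tuple_eta.
rewrite -(pair_big_dep (fun i : 'I_N.+1 => (m < i)%N)
  (fun i t => path ltn i [seq val j | j <- val t])
  (fun i t => \prod_(j < (size a).+1)
    ((tnth (cons_tuple (i, t)) j)%:R + s) ^- nth 0%N (b :: a) j)) /=.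
rewrite (big_nat_widenl _ 0%N) // big_mkord; apply: eq_bigr => i _.
rewrite -IHa mulr_sumr; apply: eq_bigr => t _.
rewrite big_ord_recl /= tnth0 exprVn; congr (_ * _).
by apply: eq_bigr => j _; rewrite tnthS.
Qed.

Lemma extend_zeta_lin y s : supported (all (leq 2)) y ->
  (fun N => extend (nested (fun n => (n%:R + s)^-1) N ^~ 0%N) y) @ \oo
    --> zeta_lin y s.
Proof.
move=> /allP y2; have [A A_ge0 xA] := inv_shift_bound s.
apply: cvg_finsum => a ay.
have zE : zeta_partial a s = fun N => nested (fun n => (n%:R + s)^-1) N a 0.
  by apply/funext => N; exact: zeta_partial_nested.
rewrite /zeta zE.
apply: cvgMl_tmp; apply: (cvg_nested A_ge0); first exact: xA.
exact: y2.
Qed.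

Definition power_sum z b : CC R := limn (series (fun n => (n.+1%:R + z)^-1 ^+ b)).

Lemma log_deriv_reg_series :
  log_deriv reg_series (fun i => if i is 0 then 0 else (-1) ^+ i).
Proof.
have := log_deriv_conv (log_deriv_linear (1 : rat)) (log_deriv_exp (- 1)).
congr log_deriv; apply/funext => -[|i] /=.
  by rewrite expr1n mulr1 addrN.
by rewrite expr1n mulr1 addr0.
Qed.

Lemma log_deriv_zeta_lin s :
  log_deriv (fun n => zeta_lin (letterwise reg_series n) s)
    (fun i => if i is 0 then 0 else (-1) ^+ i * power_sum s i.+1).
Proof.
apply: (log_deriv_lim (fun N => log_deriv_nested _ log_deriv_reg_series (leq0n N))).
  by move=> n; apply: extend_zeta_lin; exact: supported_letterwise reg_series1.
move=> [|i].
  rewrite rmorph0 [X in X @ _](_ : _ = fun=> 0); first exact: cvg_cst.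
  by apply/funext => N; rewrite mul0r.
rewrite rmorphXn rmorphN1; apply: cvgMl_tmp.
have [A A_ge0 xA] := inv_shift_bound s.
rewrite (_ : (fun N => _) = series (fun n => (n.+1%:R + s)^-1 ^+ i.+2)).
  exact: (@cvg_power_sum (fun n => (n%:R + s)^-1) A A_ge0 xA i.+2 isT).
by apply/funext => N; rewrite big_add1.
Qed.

(** In other words, the generating series of the regularized values at (1,...,1)
is the exponential of [X t] plus the alternating sum of the [zeta(i; s) t^i / i]
over [i >= 2]. *)
Lemma log_deriv_zeta_reg X s :
  log_deriv (fun r => zeta_reg X (nseq r 1%N) s)
    (fun i => if i is 0 then X else (-1) ^+ i * power_sum s i.+1).
Proof.
have := log_deriv_conv (log_deriv_exp X) (log_deriv_zeta_lin s).
congr log_deriv; apply/funext => r; last first.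
  by case: r => [|r]; rewrite ?addr0 ?add0r.
rewrite /zeta_reg decomposition_ones size_nseq; apply: eq_bigr => l _.
rewrite ffunE [RHS]mulrC /exp_series mulrAC -mulrA; congr (_ * _).
rewrite -[RHS]/(extend (zeta^~ s) _) extendZ fmorphV /= ratr_nat mulrC.
by [].
Qed.

End RegularizedValues.
(** * The multitangent functions at (1,...,1) *)

Section Multitangent.
Variables (R : realType) (s : CC R).
Hypothesis hs : forall n : int, s != n%:~R.

Lemma natD_neq0 n : n%:R + s != 0.
Proof.
apply: contra_neq (hs (- n%:Z)) => ns0.
by rewrite mulrNz -pmulrn; apply/eqP; rewrite -addr_eq0 addrC ns0.
Qed.

Lemma natB_neq0 n : n%:R - s != 0.
Proof. by rewrite subr_eq0 eq_sym; exact: hs n%:Z. Qed.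

Lemma cvg_harmonic_fun (z : CC R) : (forall n, n.+1%:R + z != 0) ->
  series (fun n => n.+1%:R^-1 - (n.+1%:R + z)^-1) @ \oo --> harmonic_fun z.
Proof.
move=> z_neq; have [A A_ge0 zA] := inv_shift_bound z.
apply: (@series_abs_cvg _ _ (modulus z * A *: (inv_square R : nat -> R))).
  move=> n; have n0 : n.+1%:R != 0 :> CC R by rewrite pnatr_eq0.
  have -> : n.+1%:R^-1 - (n.+1%:R + z)^-1 = z * (n.+1%:R + z)^-1 * n.+1%:R^-1.
    have inv_sub (t : CC R) : t != 0 -> t + z != 0 ->
        t^-1 - (t + z)^-1 = z * (t + z)^-1 * t^-1.
      by move=> t0 tz0; field; rewrite t0 tz0.
    exact: inv_sub.
  rewrite normrM normrM [`|n.+1%:R^-1|]normfV normr_nat [`|z|]modulusE.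
  have -> : toC ((modulus z * A *: (inv_square R : nat -> R)) n) =
      toC (modulus z) * toC (A / n.+1%:R) * (n.+1%:R)^-1.
    rewrite -(toC_nat R n.+1) -toCV -!toCM; congr toC.
    transitivity (modulus z * A * inv_square R n) => //.
    by rewrite /inv_square -exprVn expr2 !mulrA.
  apply: ler_wpM2r; first by rewrite invr_ge0.
  by apply: ler_wpM2l; [rewrite (ler_toC 0) modulus_ge0|exact: zA].
by apply: is_cvg_seriesZ; exact: cvg_inv_square.
Qed.

(** The sum of [(s + n)^(- b)] over the integers [n] with [|n| <= N]. Opposite
indices are paired because for [b = 1] only the paired series converges. *)
Definition symmetric_sum b N : CC R :=
  s^-1 ^+ b + \sum_(0 <= k < N) ((s + k.+1%:R)^-1 ^+ b + (s - k.+1%:R)^-1 ^+ b).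

(** The two sums in the definition are the coefficients of the products by 1 and
by [t / s] of one and the same series. *)
Lemma multitangent_ones T r : multitangent T (nseq r 1%N) s =
  conv (linear_series s^-1)
    (conv (fun j => (-1) ^+ j * zeta_reg (T - harmonic_fun (- s)) (nseq j 1%N) (- s))
       (fun j => zeta_reg (T - harmonic_fun s) (nseq j 1%N) s)) r.
Proof.
have weightE j : weight (nseq j 1%N) = j by elim: j => //= j; rewrite /weight /= => ->.
have takeE j : (j <= r)%N -> take j (nseq r 1%N) = nseq j 1%N.
  by move=> jr; rewrite take_nseq.
have dropE j : drop j (nseq r 1%N) = nseq (r - j) 1%N by rewrite drop_nseq.
have revE j : rev (nseq j 1%N) = nseq j 1%N by rewrite rev_nseq.
rewrite /multitangent size_nseq.
under eq_bigr => j _.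
  rewrite takeE; last by rewrite -ltnS.
  rewrite weightE revE dropE; over.
under [X in _ + X]eq_bigr => j _.
  rewrite takeE; last by rewrite ltnW.
  rewrite weightE revE dropE nth_nseq ltn_ord expr1; over.
case: r {takeE dropE} => [|r].
  by rewrite big_ord0 addr0 conv0 /linear_series mul1r.
rewrite conv_linearS; congr (_ + _); rewrite /conv mulr_sumr.
apply: eq_bigr => j _; rewrite subSS; ring.
Qed.

(** Logarithmic derivatives turn the product into sums of power sums over the
positive and the negative integers and 0. The parameter [T] occurs only in the
constant coefficient, with opposite signs, and there the difference of the two
harmonic functions is the sum of the [1 / (s + n) + 1 / (s - n)] over [n > 0]. *)
Lemma log_deriv_multitangent T : exists Q : nat -> CC R,
  log_deriv (fun r => multitangent T (nseq r 1%N) s) Q /\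
  forall i, (fun N => (-1) ^+ i * symmetric_sum i.+1 N) @ \oo --> Q i.
Proof.
have := log_deriv_conv (log_deriv_linear s^-1) (log_deriv_conv
  (log_deriv_scale (-1) (log_deriv_zeta_reg (T - harmonic_fun (- s)) (- s)))
  (log_deriv_zeta_reg (T - harmonic_fun s) s)).
set Q := (X in log_deriv _ X) => fQ; exists Q; split.
  by have -> := funext (multitangent_ones T); exact: fQ.
move=> [|i].
  have Hp := cvg_harmonic_fun (fun n => natD_neq0 n.+1).
  have Hm := cvg_harmonic_fun (fun n => natB_neq0 n.+1).
  have -> : Q 0%N = s^-1 + (harmonic_fun (- s) - harmonic_fun s).
    by rewrite /Q expr0 !expr1; ring.
  have -> : (fun N => (-1) ^+ 0 * symmetric_sum 1 N) = fun N => s^-1 +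
      (series (fun n => n.+1%:R^-1 - (n.+1%:R - s)^-1) N -
       series (fun n => n.+1%:R^-1 - (n.+1%:R + s)^-1) N).
    apply/funext => N; rewrite mul1r /symmetric_sum expr1 /series /= -sumrB.
    congr (_ + _); apply: eq_bigr => k _; rewrite !expr1 [s + _]addrC.
    by rewrite -(opprB _ s) invrN; ring.
  exact: (cvgD (cvg_cst (s^-1 : CC R)) (cvgB Hm Hp)).
have [A A_ge0 xA] := inv_shift_bound s.
have [B B_ge0 xB] := inv_shift_bound (- s).
have cp : series (fun n => (n.+1%:R + s)^-1 ^+ i.+2) @ \oo --> power_sum s i.+2.
  exact: (@cvg_power_sum _ (fun n => (n%:R + s)^-1) A A_ge0 xA i.+2 isT).
have cm : series (fun n => (n.+1%:R - s)^-1 ^+ i.+2) @ \oo --> power_sum (- s) i.+2.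
  exact: (@cvg_power_sum _ (fun n => (n%:R - s)^-1) B B_ge0 xB i.+2 isT).
have -> : Q i.+1 = (-1) ^+ i.+1 * (s^-1 ^+ i.+2 +
    (power_sum s i.+2 + (-1) ^+ i.+2 * power_sum (- s) i.+2)).
  rewrite /Q; move: ((-1) ^+ i.+1) ((-1) ^+ i.+2) (s^-1 ^+ i.+2).
  by move: (power_sum s i.+2) (power_sum (- s) i.+2) => p m e e' t; ring.
apply: cvg_const_mul.
have -> : symmetric_sum i.+2 = fun N => s^-1 ^+ i.+2 +
    (series (fun n => (n.+1%:R + s)^-1 ^+ i.+2) N +
     (-1) ^+ i.+2 * series (fun n => (n.+1%:R - s)^-1 ^+ i.+2) N).
  apply/funext => N; congr (_ + _).
  rewrite /series /= mulr_sumr -big_split; apply: eq_bigr => k _ /=.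
  rewrite [s + _]addrC; congr (_ + _).
  by rewrite -(opprB _ s) invrN [LHS]exprNn.
exact: (cvgD (cvg_cst (s^-1 ^+ i.+2 : CC R))
  (cvgD cp (cvg_const_mul (w := (-1) ^+ i.+2) cm))).
Qed.

End Multitangent.
(** * A finite product of cotangents *)

Lemma prod_prim_root (K : fieldType) n (w a b : K) : n.-primitive_root w ->
  \prod_(0 <= k < n) (b - w ^+ k * a) = b ^+ n - a ^+ n.
Proof.
move=> prim_w; have n_gt0 := prim_order_gt0 prim_w.
have [->|a0] := eqVneq a 0.
  rewrite expr0n gtn_eqF // subr0 -[in RHS](subn0 n) -prodr_const_nat.
  by apply: eq_bigr => k _; rewrite mulr0 subr0.
have aE : \prod_(0 <= k < n) a = a ^+ n by rewrite prodr_const_nat subn0.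
have := congr1 (fun p => a ^+ n * p.[b / a]) (factor_Xn_sub_1 prim_w).
rewrite !hornerE horner_prod -{1}aE -big_split /=.
rewrite expr_div_n mulrBr mulr1 [a ^+ n * (_ / _)]mulrC divfK ?expf_neq0 // => <-.
apply: eq_bigr => k _.
by rewrite !hornerE mulrBr [a * (_ / _)]mulrC divfK // [a * _]mulrC.
Qed.

Lemma eq_poly_horner (K : numFieldType) (p q : {poly K}) :
  (forall t, p.[t] = q.[t]) -> p = q.
Proof.
move=> pq; apply/eqP; rewrite -subr_eq0; apply/eqP.
apply: (@roots_geq_poly_eq0 _ _ [seq k%:R | k <- iota 0 (size (p - q))]).
- by apply/allP => _ /mapP[k _ ->]; rewrite /root !hornerE pq subrr.
- by rewrite map_inj_uniq ?iota_uniq // => i j /eqP; rewrite eqr_nat => /eqP.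
by rewrite size_map size_iota.
Qed.

Lemma coef_comp_scaleX (K : comNzRingType) (p : {poly K}) c r :
  (p \Po (c *: 'X))`_r = c ^+ r * p`_r.
Proof.
rewrite coef_comp_poly.
under eq_bigr => i _ do rewrite exprZn coefZ coefXn.
have [ltrp|lepr] := ltnP r (size p).
  rewrite (bigD1 (Ordinal ltrp)) //= eqxx mulr1 mulrC big1 ?addr0 // => i.
  by rewrite -val_eqE eq_sym /= => /negPf ->; rewrite !mulr0.
rewrite nth_default // mulr0 big1 // => i _.
by rewrite gtn_eqF ?mulr0 // (leq_trans (ltn_ord i)).
Qed.

Section CotangentProduct.
Variables (K : numFieldType) (im w q : K) (n : nat).
Hypotheses (prim_w : n.-primitive_root w) (n_odd : odd n).
Hypothesis qn_neq1 : q ^+ n != 1.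

(** With [q = exp (2 i x)] and [w = exp (2 i pi / n)], the number below is
[cot (x + k pi / n)]. *)
Definition cayley_cot (k : nat) : K := im * (q * w ^+ k + 1) / (q * w ^+ k - 1).

Lemma qw_neq1 k : q * w ^+ k - 1 != 0.
Proof.
apply: contra_neq qn_neq1 => /eqP; rewrite subr_eq0 => /eqP qw1.
have : (q * w ^+ k) ^+ n = 1 by rewrite qw1 expr1n.
by rewrite exprMn exprAC (prim_expr_order prim_w) expr1n mulr1.
Qed.

Lemma prod_homogeneous a b :
  \prod_(0 <= k < n) (q * w ^+ k * a - b) = q ^+ n * a ^+ n - b ^+ n.
Proof.
transitivity ((-1) ^+ n * \prod_(0 <= k < n) (b - w ^+ k * (q * a))).
  have -> : (-1) ^+ n = \prod_(0 <= k < n) (-1) :> K.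
    by rewrite prodr_const_nat subn0.
  by rewrite -big_split /=; apply: eq_bigr => k _; ring.
by rewrite (prod_prim_root _ _ prim_w) exprMn -signr_odd n_odd mulN1r opprB.
Qed.

(** The addition formula for the cotangent of a multiple angle. With
[z = q * w ^+ k], the factor of index [k] is the quotient by [z - 1] of
[z (1 + im t) - (1 - im t)]; the product of these numerators over [k] is the
difference of the [n]th powers. *)
Lemma prod_cayley_cot : \prod_(0 <= k < n) (1 + cayley_cot k *: 'X) =
  (q ^+ n - 1)^-1 *:
    (q ^+ n *: (1 + im *: 'X) ^+ n - (1 + (- im) *: 'X) ^+ n) :> {poly K}.
Proof.
apply: eq_poly_horner => t.
have Q_neq : q ^+ n - 1 != 0 by rewrite subr_eq0.
rewrite horner_prod !hornerE.
rewrite mulNr -prod_homogeneous.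
have := prod_homogeneous 1 1; rewrite !expr1n mulr1 => <-.
rewrite -prodfV -big_split /=; apply: eq_bigr => k _.
rewrite !hornerE /cayley_cot ?mulr1; have := qw_neq1 k.
move: (q * w ^+ k) => z z_neq.
have -> : im * (z + 1) / (z - 1) * t = (z - 1)^-1 * (im * (z + 1) * t) by ring.
apply: (mulfI z_neq); rewrite mulrDr mulr1 mulVKf // mulVKf //; ring.
Qed.

Lemma coef_linear_exp (a : K) m r :
  ((1 + a *: 'X) ^+ m : {poly K})`_r = 'C(m, r)%:R * a ^+ r.
Proof.
elim: m r => [|m IHm] r.
  by rewrite expr0 coef1; case: r => [|r]; rewrite ?mulr1 // bin0n mul0r.
rewrite exprS mulrDl mul1r -scalerAl coefD coefZ coefXM !IHm.
case: r => [|r]; first by rewrite mulr0 addr0 !bin0.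
by rewrite binS natrD /= exprS; ring.
Qed.

Lemma im_exp_opp r : (- im) ^+ r = (-1) ^+ r * im ^+ r.
Proof. by rewrite -exprMn mulN1r. Qed.

Lemma elementary_cayley_cot (c : K) r :
  (\prod_(0 <= k < n) (1 + (c * cayley_cot k) *: 'X))`_r =
  'C(n, r)%:R * (c * im) ^+ r * ((q ^+ n - (-1) ^+ r) / (q ^+ n - 1)).
Proof.
have -> : \prod_(0 <= k < n) (1 + (c * cayley_cot k) *: 'X) =
    (\prod_(0 <= k < n) (1 + cayley_cot k *: 'X)) \Po (c *: 'X).
  rewrite rmorph_prod; apply: eq_bigr => k _ /=.
  by rewrite comp_polyD comp_polyC comp_polyZ comp_polyX scalerA mulrC.
rewrite coef_comp_scaleX prod_cayley_cot !(coefZ, coefB) !coef_linear_exp im_exp_opp.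
by rewrite exprMn; ring.
Qed.

End CotangentProduct.
(** * Roots of unity and cotangents over the complex numbers *)

Section ExponentialPeriod.
Variable R : realType.
Implicit Types (z w : CC R) (x : R).

Definition Euni z : CC R := Cexp (2%:R * (Ci * Cpi) * z).

Lemma Ci_neq0 : (Ci : CC R) != 0.
Proof.
by rewrite -sqrf_eq0 Ci_sqr oppr_eq0 oner_eq0.
Qed.

Lemma Cpi_neq0 : (Cpi : CC R) != 0.
Proof. by rewrite -[Cpi]/(toC pi) eq_complex /= eqxx andbT gt_eqF // pi_gt0. Qed.

Lemma EuniD z w : Euni (z + w) = Euni z * Euni w.
Proof. by rewrite /Euni mulrDr CexpD. Qed.

Lemma EuniX z n : Euni (n%:R * z) = Euni z ^+ n.
Proof. by rewrite /Euni mulrCA CexpM_nat. Qed.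

Lemma EuniN z : Euni (- z) = (Euni z)^-1.
Proof. by rewrite /Euni mulrN CexpN. Qed.

Lemma Euni_neq0 z : Euni z != 0. Proof. exact: Cexp_neq0. Qed.

Lemma Euni_real x : Euni (toC x) = (cos (x *+ 2 * pi) +i* sin (x *+ 2 * pi))%C.
Proof.
have -> : Euni (toC x) = Cexp (0 +i* (x *+ 2 * pi))%C.
  congr Cexp; rewrite -[2%:R](toC_nat R 2) /toC /Ci /Cpi; simpc.
  by congr (_ +i* _)%C; rewrite mulr2n; ring.
by rewrite /Cexp expR0 !mul1r.
Qed.

Lemma Euni1 : Euni 1 = 1.
Proof. by rewrite -(toC1 R) Euni_real mulrC -mulr_natr mul1r mulr_natr cos2pi sin2pi. Qed.

Lemma norm_Euni_real x : `|Euni (toC x)| = 1.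
Proof. by rewrite Euni_real normc_def /= cos2Dsin2 sqrtr1. Qed.

Lemma sin_ge_mul_cos (t : R) : 0 <= t -> t <= pi / 2 -> t * cos t <= sin t.
Proof.
move=> t0 tpi.
have pi0 := @pi_gt0 R.
have [c /itvP c0t] := @MVT_segment R sin cos 0 t t0
  (fun x _ => is_derive_sin x) (continuous_subspaceT (@continuous_sin R)).
rewrite sin0 !subr0 mulrC => ->; apply: ler_wpM2l => //.
have [c_ge0 c_let] : 0 <= c /\ c <= t by rewrite !c0t.
have [->//|ct] := eqVneq c t.
by apply: ltW; rewrite ltr_cos ?in_itv /= ?lt_neqAle ?ct //; lra.
Qed.

(** Chords are bounded below by arcs: with [t = pi |x|], the inequality
[t cos t <= sin t] gives [sin^2 t >= t^2 / (1 + t^2)], where [2 |x| <= t <= 2]. *)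
Lemma norm_Euni_sub1_real x : `|x| <= 2^-1 -> toC `|x| <= `|Euni (toC x) - 1|.
Proof.
move=> x_le; rewrite Euni_real normc_def /toC lecR /=.
rewrite -sqrtr_sqr; apply: ler_wsqrtr.
set y := x * pi.
have -> : x *+ 2 * pi = y *+ 2 by rewrite /y mulrnAl.
rewrite subr0 cos_mulr2n sin_mulr2n.
have pi2 := @pi_ge2 R; have pi4 := @pihalf_lt2 R; have pi0 := @pi_gt0 R.
have bound : x ^+ 2 <= 4 * sin y ^+ 2.
  have -> : sin y ^+ 2 = sin (`|x| * pi) ^+ 2.
    rewrite /y; case: (ger0P x) => // _; by rewrite mulNr sinN sqrrN.
  rewrite -(real_normK (num_real x)); move: (`|x|) (normr_ge0 x) x_le => {y}a a0 a_le.
  have y0 : 0 <= a * pi by rewrite mulr_ge0 // ltW.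
  have y_le : a * pi <= pi / 2 by rewrite mulrC; apply: ler_wpM2l => //; exact: ltW.
  have y_ge : 2 * a <= a * pi by rewrite mulrC; apply: ler_wpM2l.
  have h := sin_ge_mul_cos y0 y_le; have e := cos2Dsin2 (a * pi).
  have c0 : 0 <= cos (a * pi) by apply: cos_ge0_pihalf; lra.
  move: (sin (a * pi)) (cos (a * pi)) h e c0 => S C h e c0.
  move: (a * pi) y0 y_le y_ge h => y y0 y_le y_ge h.
  have h2 : y ^+ 2 * (1 - S ^+ 2) <= S ^+ 2.
    have -> : 1 - S ^+ 2 = C ^+ 2 by rewrite -e addrK.
    by rewrite -exprMn lerXn2r // nnegrE ?mulr_ge0 // (le_trans _ h) // mulr_ge0.
  have y2 : y ^+ 2 <= 4 by nra.
  have ya : 4 * a ^+ 2 <= y ^+ 2 by nra.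
  have S2 : 0 <= S ^+ 2 by exact: sqr_ge0.
  by nra.
apply: le_trans bound _; have := cos2Dsin2 y.
by move: (sin y) (cos y) => S C e; rewrite !mulr2n; nra.
Qed.

Lemma Euni_int (n : int) : Euni n%:~R = 1.
Proof.
have nat1 (m : nat) : Euni m%:R = 1 by rewrite -[m%:R]mulr1 EuniX Euni1 expr1n.
by case: n => n; [exact: nat1|rewrite NegzE mulrNz EuniN nat1 invr1].
Qed.

Lemma Euni_eq1 z : Euni z = 1 -> exists n : int, z = n%:~R.
Proof.
case: z => x y z1.
have pi0 := @pi_gt0 R.
have y0 : y = 0.
  move: z1; rewrite /Euni -[2%:R](toC_nat R 2) /toC /Ci /Cpi; simpc.
  rewrite /Cexp => -[]; set a := expR _; set b := (X in cos X).
  have a0 : 0 < a by exact: expR_gt0.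
  move=> ac as0; have sb0 : sin b = 0.
    by apply/eqP; move/eqP: as0; rewrite mulf_eq0 gt_eqF.
  have a1 : a = 1.
    have := cos2Dsin2 b; rewrite sb0 expr0n /= addr0 => c1.
    have c0 : 0 < cos b by rewrite -(pmulr_rgt0 _ a0) ac.
    have : (cos b - 1) * (cos b + 1) = 0 by lra.
    move/eqP; rewrite mulf_eq0 => /orP[/eqP cb|/eqP cb]; last by lra.
    by rewrite -ac (_ : cos b = 1) ?mulr1 //; lra.
  move: a1; rewrite /a => /(congr1 (@ln R)); rewrite expRK ln1 => ab.
  apply/eqP; move/eqP: ab; rewrite oppr_eq0 mulf_eq0 => /orP[|//].
  by rewrite gt_eqF // mulr_gt0.
rewrite {}y0 in z1 *; rewrite -[(x +i* 0)%C]/(toC x) in z1 *.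
pose n := Num.floor x; pose t := x - n%:~R; exists n.
have tE : toC t = toC x - n%:~R by rewrite /t toCD toCN /toC rmorph_int.
have t_ge0 : 0 <= t by rewrite subr_ge0 real_floor_le ?num_real.
have t_lt1 : t < 1 by rewrite ltrBlDl -intrD1 real_floorD1_gt ?num_real.
have := t_ge0; rewrite le_eqVlt => /orP[/eqP t0|t_gt0].
  by apply/eqP; rewrite -subr_eq0 -tE -t0.
have : Euni (toC t) = 1 by rewrite tE EuniD EuniN Euni_int z1 invr1 mulr1.
rewrite Euni_real mulrnAl cos_mulr2n => -[c2 _].
exfalso; have : 0 < sin (t * pi).
  by rewrite sin_gt0_pi // mulr_gt0 //= gtr_pMl.
have := cos2Dsin2 (t * pi); move: c2; rewrite mulr2n; clear z1 tE.
by move: (sin (t * pi)) (cos (t * pi)) => S C; nra.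
Qed.

End ExponentialPeriod.
(** * Approximation of the partial fractions by cotangents *)

Section Modulus.
Variable R : realType.
Implicit Types z w : CC R.

Lemma modulusM z w : modulus (z * w) = modulus z * modulus w.
Proof. by apply: (@complexI R); rewrite -[LHS]modulusE normrM !modulusE -toCM. Qed.

Lemma modulusV z : modulus z^-1 = (modulus z)^-1.
Proof. by apply: (@complexI R); rewrite -[LHS]modulusE normfV modulusE -toCV. Qed.

Lemma modulusX z n : modulus (z ^+ n) = modulus z ^+ n.
Proof. by apply: (@complexI R); rewrite -[LHS]modulusE normrX modulusE -toCX. Qed.

Lemma modulus_toC (x : R) : modulus (toC x) = `|x|.
Proof. by apply: (@complexI R); rewrite -[LHS]modulusE norm_toC. Qed.

Lemma modulus_nat n : modulus (n%:R : CC R) = n%:R.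
Proof. by rewrite -(toC_nat R n) modulus_toC normr_nat. Qed.

Lemma modulusN z : modulus (- z) = modulus z.
Proof. by rewrite /modulus normrN. Qed.

Lemma modulusD z w : modulus (z + w) <= modulus z + modulus w.
Proof. by rewrite -ler_toC toCD -!modulusE ler_normD. Qed.

Lemma modulusB_ge z w : modulus z - modulus w <= modulus (z + w).
Proof.
by rewrite lerBlDr -{1}[z](addrK w) (le_trans (modulusD _ _)) // modulusN.
Qed.

Lemma modulus_Ci : modulus (Ci : CC R) = 1.
Proof.
by apply/eqP; rewrite -(@eqrXn2 _ 2) ?modulus_ge0 // -modulusX Ci_sqr modulusN
  expr1n -(toC1 R) modulus_toC normr1.
Qed.

Lemma modulus_Cpi : modulus (Cpi : CC R) = pi.
Proof. by rewrite -[Cpi]/(toC pi) modulus_toC gtr0_norm // pi_gt0. Qed.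

End Modulus.

Section CotangentApproximation.
Variable R : realType.
Implicit Types z : CC R.

(** This is [(pi / M) cot (pi z / M)]. *)
Definition cot_approx (M : nat) z : CC R :=
  Cpi / M%:R * (Ci * (Euni (z / M%:R) + 1) / (Euni (z / M%:R) - 1)).

Lemma cvg_double (u : nat -> CC R) (l : CC R) :
  u @ \oo --> l -> (fun N => u N.*2) @ \oo --> l.
Proof.
move=> ul; apply: cvg_modulus => e e0; have [N0 _ H] := cvg_modulus_inv ul e0.
by exists N0 => // N /= leN; apply: H; rewrite /= -addnn; lia.
Qed.

Lemma cvg_Euni_sub1 z : (fun N => N.*2.+1%:R * (Euni (z / N.*2.+1%:R) - 1)) @ \oo
  --> 2%:R * (Ci * Cpi) * z.
Proof.
have := cvg_double (@cvg_Cexp_near0 R (2%:R * (Ci * Cpi) * z)).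
rewrite (_ : (fun N => _) = fun N => N.*2.+1%:R * (Euni (z / N.*2.+1%:R) - 1)) //.
by apply/funext => N; rewrite /Euni -[_ * _ * z * _]mulrA.
Qed.

Lemma cvg_inv_odd : (fun N : nat => N.*2.+1%:R^-1 : CC R) @ \oo --> (0 : CC R).
Proof.
apply: (@cvg_double (fun N => N.+1%:R^-1)).
apply: (@cvg_bound _ _ _ (@harmonic R)); last exact: cvg_harmonic.
by apply: nearW => N; rewrite subr0 modulusE modulusV modulus_nat.
Qed.

Lemma cvg_cot_approx z : z != 0 -> (fun N => cot_approx N.*2.+1 z) @ \oo --> z^-1.
Proof.
move=> z0; have Ma := @cvg_Euni_sub1 z.
have b2 : (fun N => Euni (z / N.*2.+1%:R) + 1) @ \oo --> (2%:R : CC R).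
  have := cvgD (cvgM Ma cvg_inv_odd) (cvg_cst (2%:R : CC R)).
  rewrite mulr0 add0r => /(_ _ _)/= h.
  have -> : (fun N => Euni (z / N.*2.+1%:R) + 1) = (fun N =>
      N.*2.+1%:R * (Euni (z / N.*2.+1%:R) - 1) * N.*2.+1%:R^-1 + 2%:R).
    apply/funext => N; rewrite mulrAC mulfV ?pnatr_eq0 // mul1r.
    by rewrite mulr2n addrA subrK.
  exact: h.
have tau_neq : 2%:R * (Ci * Cpi) * z != 0.
  by rewrite !mulf_neq0 ?pnatr_eq0 ?Ci_neq0 ?Cpi_neq0.
have -> : z^-1 = Cpi * Ci * (2%:R * (2%:R * (Ci * Cpi) * z)^-1).
  have := Ci_neq0 R; have := Cpi_neq0 R.
  by move: (Ci : CC R) (Cpi : CC R) => i p p0 i0; field; rewrite z0 p0 i0.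
have -> : (fun N => cot_approx N.*2.+1 z) = (fun N => Cpi * Ci *
    ((Euni (z / N.*2.+1%:R) + 1) *
     (N.*2.+1%:R * (Euni (z / N.*2.+1%:R) - 1))^-1)).
  by apply/funext => N; rewrite /cot_approx invfM; ring.
apply: cvg_const_mul; exact: (cvgM b2 (cvgV tau_neq Ma)).
Qed.

Lemma modulus_Euni_real (y : R) : modulus (Euni (toC y)) = 1.
Proof. by apply: (@complexI R); rewrite -[LHS]modulusE norm_Euni_real. Qed.

(** The rotation by the angle [2 pi y] takes 1 to a distance at least [t / m],
hence takes [q], whose distance to 1 is at most half of that, to a distance at
least [t / (2 m)] from 1. *)
Lemma rotation_bounds (q : CC R) (C m t y : R) :
  0 <= C -> 1 <= m -> 1 <= t -> 2 * t <= m -> 2 * C <= t ->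
  modulus (q - 1) <= C / m -> `|y| = t / m ->
  [/\ modulus (q * Euni (toC y) - 1)^-1 <= 2 * m / t,
     q * Euni (toC y) - 1 != 0 & modulus (q * Euni (toC y) + 1) <= C + 2].
Proof.
move=> C0 m_ge1 t_ge1 t_le C_le qC yE.
have m_gt0 : 0 < m by lra.
have t_gt0 : 0 < t by lra.
have lower : t / (2 * m) <= modulus (q * Euni (toC y) - 1).
  rewrite (_ : _ - 1 = (Euni (toC y) - 1) + Euni (toC y) * (q - 1)); last by ring.
  apply: le_trans (modulusB_ge _ _); rewrite modulusM modulus_Euni_real mul1r.
  have h : t / m <= modulus (Euni (toC y) - 1).
    rewrite -yE -ler_toC -modulusE; apply: norm_Euni_sub1_real.
    by rewrite yE ler_pdivrMr //; lra.
  have -> : t / (2 * m) = t / m - t / 2 / m by field; lra.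
  have h' : C / m <= t / 2 / m by apply: ler_wpM2r; [rewrite invr_ge0; lra|lra].
  lra.
have lower_gt0 : 0 < t / (2 * m) by rewrite divr_gt0 //; lra.
split.
- rewrite modulusV -[2 * m / t]invrK invf_div lef_pV2 ?posrE //.
  exact: lt_le_trans lower.
- apply: contraTneq lower => ->.
  by rewrite -(toC0 R) modulus_toC normr0 -ltNge.
rewrite (_ : _ + 1 = Euni (toC y) * (q - 1) + (Euni (toC y) + 1)); last by ring.
apply: le_trans (modulusD _ _) _; rewrite modulusM modulus_Euni_real mul1r.
have h1 := modulusD (Euni (toC y)) 1.
rewrite modulus_Euni_real (modulus_nat R 1) in h1.
have h2 : C / m <= C by rewrite ler_pdivrMr // ler_peMr.
lra.
Qed.

Section Bounds.
Variable s : CC R.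

Lemma Euni_sub1_bound : exists2 C : R, 0 <= C & forall N : nat,
  modulus (Euni (s / N.*2.+1%:R) - 1) <= C / N.*2.+1%:R.
Proof.
have /cvg_seq_bounded/pinfty_ex_gt0[c c0 cv] :
    cvgn (fun N => N.*2.+1%:R * (Euni (s / N.*2.+1%:R) - 1)).
  by apply: cvgP; exact: cvg_Euni_sub1.
have [C C0 cC] := gt0_toC c0; exists C; first exact: ltW.
move=> N; rewrite ler_pdivlMr ?ltr0n // mulrC -(modulus_nat R) -modulusM.
by rewrite -ler_toC -modulusE -cC; exact: cv.
Qed.

(** The two terms of opposite indices nearly cancel, so that their sum is of the
order of [1 / k^2]; separately they are of the order of [1 / k]. *)
Lemma cot_approx_bound : exists B : R, exists K0 : nat, 0 <= B /\
  forall N k, (K0 <= k < N)%N ->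
  [/\ modulus (cot_approx N.*2.+1 (s + k.+1%:R)) <= B / k.+1%:R,
      modulus (cot_approx N.*2.+1 (s - k.+1%:R)) <= B / k.+1%:R &
      modulus (cot_approx N.*2.+1 (s + k.+1%:R) +
               cot_approx N.*2.+1 (s - k.+1%:R)) <= B * inv_square R k].
Proof.
have [C C0 qC] := Euni_sub1_bound; have pi0 := @pi_gt0 R.
(* The sum of the two terms requires [8 pi C (C + 2)], each of them [2 pi (C + 2)]. *)
exists (8 * pi * (C + 1) * (C + 2)), (Num.truncn (2 * C)).+1; split.
  by apply: mulr_ge0; [apply: mulr_ge0; [apply: mulr_ge0|]|]; lra.
move=> N k /andP[lek ltkN].
set m : R := N.*2.+1%:R; set t : R := k.+1%:R.
have m_ge1 : 1 <= m by rewrite ler1n.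
have t_ge1 : 1 <= t by rewrite ler1n.
have t_le : 2 * t <= m by rewrite -natrM ler_nat; lia.
have C_le : 2 * C <= t.
  by apply: le_trans (ltW (truncnS_gt _)) _; rewrite ler_nat ltnW.
have {}qC : modulus (Euni (s / N.*2.+1%:R) - 1) <= C / m := qC N.
set q := Euni _ in qC *.
have m_gt0 : 0 < m by lra.
have t_gt0 : 0 < t by lra.
have x_ge0 : 0 <= t / m by rewrite divr_ge0 // ltW.
have [invP neP addP] :=
  rotation_bounds C0 m_ge1 t_ge1 t_le C_le qC (ger0_norm x_ge0).
have [invM neM addM] :=
  rotation_bounds C0 m_ge1 t_ge1 t_le C_le qC (etrans (normrN _) (ger0_norm x_ge0)).
have q_add : modulus (q + 1) <= C + 2.
  rewrite (_ : q + 1 = (q - 1) + 2%:R); last by ring.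
  apply: le_trans (modulusD _ _) _; rewrite modulus_nat lerD2r.
  by apply: le_trans qC _; rewrite ler_pdivrMr // ler_peMr.
have single (a b : CC R) : modulus a <= C + 2 -> modulus b^-1 <= 2 * m / t ->
    modulus (Cpi / N.*2.+1%:R * (Ci * a / b)) <= 8 * pi * (C + 1) * (C + 2) / t.
  move=> a_le b_le.
  rewrite !modulusM modulus_Cpi modulus_Ci mul1r [modulus N.*2.+1%:R^-1]modulusV.
  rewrite modulus_nat -/m.
  apply: (@le_trans _ _ (pi / m * ((C + 2) * (2 * m / t)))).
    apply: ler_wpM2l; first by rewrite divr_ge0 // ltW.
    by apply: ler_pM => //; exact: modulus_ge0.
  have -> : pi / m * ((C + 2) * (2 * m / t)) = 2 * pi * (C + 2) / t.
    by field; rewrite !gt_eqF.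
  apply: ler_wpM2r; first by rewrite invr_ge0 ltW.
  apply: ler_wpM2r; first by lra.
  by rewrite -subr_ge0; have := mulr_ge0 (ltW pi0) C0; lra.
have mE : N.*2.+1%:R = toC m by rewrite /m toC_nat.
have tE : k.+1%:R = toC t by rewrite /t toC_nat.
have EuniP : Euni ((s + k.+1%:R) / N.*2.+1%:R) = q * Euni (toC (t / m)).
  by rewrite mulrDl EuniD -/q tE mE -toCV -toCM.
have EuniM : Euni ((s - k.+1%:R) / N.*2.+1%:R) = q * Euni (toC (- (t / m))).
  by rewrite mulrDl EuniD -/q mulNr tE mE -toCV -toCM -toCN.
rewrite /cot_approx EuniP EuniM; split; [exact: single|exact: single|].
have ee1 : q * Euni (toC (t / m)) * (q * Euni (toC (- (t / m)))) = q * q.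
  by rewrite toCN EuniN; have := Euni_neq0 (toC (t / m)) => e0; field.
have -> : Cpi / N.*2.+1%:R *
      (Ci * (q * Euni (toC (t / m)) + 1) / (q * Euni (toC (t / m)) - 1)) +
    Cpi / N.*2.+1%:R * (Ci * (q * Euni (toC (- (t / m))) + 1) /
      (q * Euni (toC (- (t / m))) - 1)) =
    Cpi / N.*2.+1%:R * (Ci * (2%:R * ((q - 1) * (q + 1)) *
      ((q * Euni (toC (t / m)) - 1)^-1 * (q * Euni (toC (- (t / m))) - 1)^-1))).
  rewrite -mulrDr -!(mulrA Ci) -mulrDr; congr (_ * (_ * _)).
  move: (q * Euni _) (q * Euni _) ee1 neP neM => a b ab a1 b1.
  rewrite (_ : (q - 1) * (q + 1) = b * a - 1); last by rewrite ab; ring.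
  by field; rewrite a1 b1.
rewrite !modulusM modulus_Cpi modulus_Ci mul1r [modulus N.*2.+1%:R^-1]modulusV.
rewrite !modulus_nat -/m.
apply: (@le_trans _ _ (pi / m * (2 * (C / m * (C + 2)) *
    ((2 * m / t) * (2 * m / t))))).
  apply: ler_wpM2l; first by rewrite divr_ge0 // ltW.
  apply: ler_pM; try by rewrite ?mulr_ge0 ?modulus_ge0.
    by apply: ler_wpM2l => //; apply: ler_pM => //; exact: modulus_ge0.
  by apply: ler_pM => //; exact: modulus_ge0.
have -> : pi / m * (2 * (C / m * (C + 2)) * (2 * m / t * (2 * m / t))) =
    8 * pi * C * (C + 2) * inv_square R k.
  by rewrite /inv_square -/t; field; rewrite !gt_eqF.
apply: ler_wpM2r; first exact: inv_square_ge0.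
apply: ler_wpM2r; first by rewrite addr_ge0.
apply: ler_wpM2l; first by rewrite mulr_ge0 // ltW.
by rewrite lerDl.
Qed.

End Bounds.
End CotangentApproximation.
(** * The values at (1,...,1) *)

Lemma big_odd_split (V : nmodType) (F : nat -> V) N :
  \sum_(0 <= k < N.*2.+1) F k =
  F 0%N + \sum_(0 <= k < N) (F k.+1 + F (N.*2.+1 - k.+1)%N).
Proof.
rewrite big_ltn // big_add1 /=; congr (_ + _).
rewrite -addnn (big_cat_nat (leq0n N) (leq_addr N N)) /= big_split /=.
congr (_ + _); rewrite -{1}[N]add0n big_addn addnK big_nat_rev add0n.
rewrite big_nat [RHS]big_nat; apply: eq_bigr => k /andP[_ kN].
by congr F; lia.
Qed.

Section Values.
Variables (R : realType) (s : CC R).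
Hypothesis hs : forall n : int, s != n%:~R.

Lemma Euni_s_neq1 : Euni s != 1.
Proof. by apply/eqP => /Euni_eq1[n sn]; have := hs n; rewrite sn eqxx. Qed.

Lemma s_neq0 : s != 0. Proof. exact: hs 0. Qed.

Lemma sD_neq0 k : s + k.+1%:R != 0.
Proof. by rewrite addrC; exact: natD_neq0. Qed.

Lemma sB_neq0 k : s - k.+1%:R != 0.
Proof. by rewrite subr_eq0; exact: hs k.+1%:Z. Qed.

(** The power sums of the cotangents converge to those of the partial fractions:
termwise because [cot_approx M z] tends to [1 / z], and with a domination by
[1 / k^2] once opposite indices are paired. *)
Lemma cvg_cot_power_sum j (L : CC R) :
  (fun N => symmetric_sum s j.+1 N) @ \oo --> L ->
  (fun N => cot_approx N.*2.+1 s ^+ j.+1 + \sum_(0 <= k < N)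
    (cot_approx N.*2.+1 (s + k.+1%:R) ^+ j.+1 +
     cot_approx N.*2.+1 (s - k.+1%:R) ^+ j.+1)) @ \oo --> L.
Proof.
move=> sL; have [B [K0 [B0 bound]]] := cot_approx_bound s.
pose l k : CC R := (s + k.+1%:R)^-1 ^+ j.+1 + (s - k.+1%:R)^-1 ^+ j.+1.
have lL : series l @ \oo --> L - s^-1 ^+ j.+1.
  have -> : series l = fun N => symmetric_sum s j.+1 N - s^-1 ^+ j.+1.
    by apply/funext => N; rewrite /symmetric_sum addrAC subrr add0r.
  exact: (cvgB sL (cvg_cst (s^-1 ^+ j.+1 : CC R))).
rewrite -[L](subrKC (s^-1 ^+ j.+1)).
apply: (cvgD (cvg_exp (m := j.+1) (cvg_cot_approx s_neq0))).
pose g (k : nat) : R := (B + 2 * B ^+ j.+1) * inv_square R k.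
have Bj0 : 0 <= B ^+ j.+1 by exact: exprn_ge0.
apply: (@tannery _ (fun N k => cot_approx N.*2.+1 (s + k.+1%:R) ^+ j.+1 +
     cot_approx N.*2.+1 (s - k.+1%:R) ^+ j.+1) l g 0 K0 _ _ _ _ lL).
- have -> : g = (B + 2 * B ^+ j.+1) *: (inv_square R : nat -> R) by [].
  by apply: is_cvg_seriesZ; exact: cvg_inv_square.
- move=> N k _ kN; have [bP bM bS] := bound N k kN.
  rewrite modulusE ler_toC /g.
  have [j0|j_gt0] := posnP j.
    rewrite j0 !expr1; apply: le_trans bS _; rewrite j0 expr1 in Bj0 *.
    by apply: ler_wpM2r; [exact: inv_square_ge0|lra].
  have pow (b : R) : 0 <= b -> b <= B / k.+1%:R ->
      b ^+ j.+1 <= B ^+ j.+1 * inv_square R k.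
    move=> b0 bB; apply: (@le_trans _ _ ((B / k.+1%:R) ^+ j.+1)).
      by apply: lerXn2r; rewrite ?nnegrE // (le_trans b0).
    rewrite exprMn; apply: ler_wpM2l => //.
    rewrite /inv_square -exprVn; apply: ler_wiXn2l => //.
    by rewrite invf_le1 ?ltr0n // ler1n.
  apply: le_trans (modulusD _ _) _; rewrite !modulusX.
  apply: le_trans (lerD (pow _ (modulus_ge0 _) bP) (pow _ (modulus_ge0 _) bM)) _.
  rewrite -mulrDl; apply: ler_wpM2r; first exact: inv_square_ge0.
  lra.
move=> k; exact: (cvgD (cvg_exp (m := j.+1) (cvg_cot_approx (sD_neq0 k)))
  (cvg_exp (m := j.+1) (cvg_cot_approx (sB_neq0 k)))).
Qed.

Lemma prim_root_Euni M : (0 < M)%N -> M.-primitive_root (Euni M%:R^-1 : CC R).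
Proof.
move=> M_gt0; have M0 : M%:R != 0 :> CC R by rewrite pnatr_eq0 -lt0n.
have EuniXM d : (Euni M%:R^-1 : CC R) ^+ d = 1 -> exists n : int, (d%:Z = n * M%:Z)%R.
  rewrite -EuniX => /Euni_eq1[n dn]; exists n.
  apply: (@intr_inj (CC R)).
  by rewrite intrM -dn -!pmulrn divfK.
have EM : (Euni M%:R^-1 : CC R) ^+ M = 1 by rewrite -EuniX mulfV // Euni1.
rewrite /primitive_root_of_unity M_gt0; apply/forallP => -[i /= ltiM].
rewrite unity_rootE; apply/eqP; have [->|neq] := eqVneq i.+1 M.
  by rewrite EM eqxx.
apply/negbTE/eqP => /EuniXM[n dn].
have n_gt0 : (0 < n)%R by nia.
have : (M%:Z <= i.+1%:Z)%R by nia.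
lia.
Qed.

Lemma cot_approx_cayley N k :
  cot_approx N.*2.+1 (s + k%:R) =
  Cpi / N.*2.+1%:R * cayley_cot Ci (Euni N.*2.+1%:R^-1) (Euni (s / N.*2.+1%:R)) k.
Proof.
by rewrite /cot_approx /cayley_cot mulrDl EuniD EuniX.
Qed.

Lemma cot_approx_period N k : (k <= N.*2.+1)%N ->
  cot_approx N.*2.+1 (s + (N.*2.+1 - k)%:R) = cot_approx N.*2.+1 (s - k%:R).
Proof.
move=> kM; rewrite /cot_approx natrB // [s + _]addrCA mulrDl mulfV ?pnatr_eq0 //.
by rewrite EuniD Euni1 mul1r.
Qed.

(** With [Q = Euni s], these are the coefficients of
[(Q exp (i pi u) - exp (- i pi u)) / (Q - 1)], that is, of the quotient of
[sin (pi (s + u))] by [sin (pi s)]. *)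
Definition ones_value r : CC R :=
  exp_series (Cpi * Ci) r * ((Euni s - (-1) ^+ r) / (Euni s - 1)).

Lemma cvg_ffact_pow r :
  (fun N : nat => (N.*2.+1 ^_ r)%:R / N.*2.+1%:R ^+ r : CC R) @ \oo --> (1 : CC R).
Proof.
elim: r => [|r IHr].
  rewrite [X in X @ _](_ : _ = fun=> 1); first exact: cvg_cst.
  by apply/funext => N; rewrite ffactn0 expr0 divr1.
have one : (fun N : nat => 1 - r%:R * N.*2.+1%:R^-1 : CC R) @ \oo --> (1 - r%:R * 0 : CC R).
  exact: (cvgB (cvg_cst (1 : CC R)) (cvg_const_mul (w := r%:R) (@cvg_inv_odd R))).
rewrite mulr0 subr0 in one; rewrite -[X in _ --> X](mulr1 1).
rewrite [X in X @ _](_ : _ = fun N : nat => (N.*2.+1 ^_ r)%:R / N.*2.+1%:R ^+ r *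
    (1 - r%:R * N.*2.+1%:R^-1)); first exact: (cvgM IHr one).
apply/funext => N; rewrite ffactnSr natrM.
have N0 : N.*2.+1%:R != 0 :> CC R by rewrite pnatr_eq0.
have [leN|ltN] := leqP r N.*2.+1; last by rewrite ffact_small // !mul0r.
rewrite natrB // exprSr; move: (N.*2.+1%:R) N0 => t t0.
by field; rewrite ?expf_neq0 t0.
Qed.

Lemma cvg_bin_pow r :
  (fun N : nat => 'C(N.*2.+1, r)%:R / N.*2.+1%:R ^+ r : CC R) @ \oo --> (r`!%:R^-1 : CC R).
Proof.
have r0 : r`!%:R != 0 :> CC R by rewrite pnatr_eq0 -lt0n fact_gt0.
have := cvg_const_mul (w := r`!%:R^-1) (@cvg_ffact_pow r); rewrite mulr1.
rewrite (_ : (fun N => _) = fun N => 'C(N.*2.+1, r)%:R / N.*2.+1%:R ^+ r) //.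
by apply/funext => N; rewrite -bin_ffact natrM mulrA [_^-1 * _]mulrC mulfK.
Qed.

(** The elementary symmetric functions of the [M] cotangents are known in closed
form, their limits are the [ones_value r], and their power sums have the same
limits as those of the [1 / (s + n)]. Both sides thus satisfy the same Newton
recursion. *)
Lemma multitangent_ones_value T r :
  multitangent T (nseq r 1%N) s = ones_value r.
Proof.
have [Q [mtQ symQ]] := log_deriv_multitangent hs T.
apply: log_deriv_unique mtQ _ r.
pose y N k := Cpi / N.*2.+1%:R *
  cayley_cot Ci (Euni N.*2.+1%:R^-1) (Euni (s / N.*2.+1%:R)) k.
apply: (log_deriv_lim (fun N => log_deriv_prod (y N) (index_iota 0 N.*2.+1))).
  move=> r; have Qn N : Euni (s / N.*2.+1%:R) ^+ N.*2.+1 = Euni s.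
    by rewrite -EuniX mulrC divfK ?pnatr_eq0.
  have -> : (fun N => (\prod_(k <- index_iota 0 N.*2.+1) (1 + y N k *: 'X))`_r) =
      fun N => 'C(N.*2.+1, r)%:R / N.*2.+1%:R ^+ r *
        ((Cpi * Ci) ^+ r * ((Euni s - (-1) ^+ r) / (Euni s - 1))).
    apply/funext => N; rewrite elementary_cayley_cot ?Qn ?Euni_s_neq1 //=.
    - by rewrite !exprMn exprVn; ring.
    - exact: prim_root_Euni.
    - by rewrite odd_double.
  have -> : ones_value r = r`!%:R^-1 *
      ((Cpi * Ci) ^+ r * ((Euni s - (-1) ^+ r) / (Euni s - 1))).
    by rewrite /ones_value /exp_series mulrAC mulrC.
  have h := @cvg_bin_pow r; exact: (cvgMr_tmp h).
move=> i.
have [e e_sqr] : exists e : CC R, e = (-1) ^+ i by exists ((-1) ^+ i).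
have ee1 : e * e = 1 by rewrite e_sqr -expr2 sqrr_sign.
have sumL : (fun N => symmetric_sum s i.+1 N) @ \oo --> e * Q i.
  have := cvg_const_mul (w := e) (symQ i).
  rewrite (_ : (fun N => _) = fun N => symmetric_sum s i.+1 N) //.
  by apply/funext => N; rewrite -e_sqr mulrA ee1 mul1r.
have := cvg_const_mul (w := e) (cvg_cot_power_sum sumL); rewrite mulrA ee1 mul1r.
rewrite (_ : (fun N => _) = fun N =>
  (-1) ^+ i * \sum_(k <- index_iota 0 N.*2.+1) y N k ^+ i.+1) //.
apply/funext => N; rewrite -e_sqr big_odd_split; congr (_ * (_ + _)).
  by rewrite /y -cot_approx_cayley addr0.
rewrite big_nat [RHS]big_nat; apply: eq_bigr => k /andP[_ kN].
rewrite /y -!cot_approx_cayley cot_approx_period //.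
by rewrite -addnn; lia.
Qed.

End Values.
(** * Trigonometric form of the values *)

Section Trigonometry.
Variables (R : realType) (s : CC R).
Hypothesis hs : forall n : int, s != n%:~R.

Let half := Cexp (Ci * (Cpi * s)).

Lemma Euni_half : Euni s = half ^+ 2.
Proof. by rewrite -CexpM_nat /Euni !mulrA. Qed.

Lemma Csin_ratio (u : CC R) :
  Csin (Cpi * (s + u)) / Csin (Cpi * s) =
  (Euni s * Cexp (Cpi * Ci * u) - Cexp (- (Cpi * Ci * u))) / (Euni s - 1).
Proof.
have Q1 := Euni_s_neq1 hs; rewrite -subr_eq0 Euni_half in Q1.
rewrite /Csin Euni_half !mulrDr opprD !CexpD !CexpN -/half.
rewrite [Cpi * Ci * u](_ : _ = Ci * (Cpi * u)); last by ring.
have a0 : half != 0 by exact: Cexp_neq0.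
have b0 := Cexp_neq0 (Ci * (Cpi * u)); have i0 := Ci_neq0 R.
move: half (Cexp (Ci * (Cpi * u))) (Ci : CC R) Q1 a0 b0 i0 => a b i Q1 a0 b0 i0.
have a1 : a * a - 1 != 0 by rewrite -expr2.
by field; rewrite ?a0 ?b0 ?i0 ?Q1 ?a1.
Qed.

Lemma Ccot_half : Ccot (Cpi * s) = Ci * (Euni s + 1) / (Euni s - 1).
Proof.
have Q1 := Euni_s_neq1 hs; rewrite -subr_eq0 Euni_half in Q1.
rewrite /Ccot /Ccos /Csin Euni_half CexpN -/half.
have a0 : half != 0 by exact: Cexp_neq0.
have i0 := Ci_neq0 R.
move: half (Ci : CC R) Q1 a0 i0 => a i Q1 a0 i0.
have a1 : a * a - 1 != 0 by rewrite -expr2.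
by field; rewrite ?a0 ?i0 ?Q1 ?a1.
Qed.

Lemma cvg_ones_value_series (u : CC R) :
  series (fun r => ones_value s r * u ^+ r) @ \oo -->
    (Csin (Cpi * (s + u)) / Csin (Cpi * s) : CC R).
Proof.
rewrite Csin_ratio.
have -> : series (fun r => ones_value s r * u ^+ r) = fun N =>
    (Euni s * series (exp_series (Cpi * Ci * u)) N -
     series (exp_series (- (Cpi * Ci * u))) N) * (Euni s - 1)^-1.
  apply/funext => N; rewrite /series /= mulr_sumr -sumrB mulr_suml.
  apply: eq_bigr => r _; rewrite /ones_value /exp_series.
  by rewrite [(- (Cpi * Ci * u)) ^+ r]exprNn !exprMn; ring.
have h : (fun N => Euni s * series (exp_series (Cpi * Ci * u)) N -
    series (exp_series (- (Cpi * Ci * u))) N) @ \oo -->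
    Euni s * Cexp (Cpi * Ci * u) - Cexp (- (Cpi * Ci * u)).
  exact: (cvgB (cvg_const_mul (w := Euni s) (@cvg_exp_series R (Cpi * Ci * u)))
  (@cvg_exp_series R (- (Cpi * Ci * u)))).
exact: (cvgMr_tmp h).
Qed.

Lemma ones_value_even m : ones_value s (2 * m) =
  (-1) ^+ m * (Cpi ^+ (2 * m) / ((2 * m)`!)%:R).
Proof.
have Q1 := Euni_s_neq1 hs; rewrite -subr_eq0 in Q1.
rewrite /ones_value /exp_series exprMn [(-1) ^+ (2 * m)]exprM sqrrN !expr1n.
by rewrite divff // mulr1 (exprM Ci) Ci_sqr; ring.
Qed.

Lemma ones_value_odd m : ones_value s (2 * m).+1 =
  (-1) ^+ m * (Cpi ^+ (2 * m).+1 / ((2 * m).+1`!)%:R) * Ccot (Cpi * s).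
Proof.
rewrite Ccot_half /ones_value /exp_series exprMn.
rewrite [(-1) ^+ (2 * m).+1]exprS exprM sqrrN !expr1n mulr1 opprK.
by rewrite [Ci ^+ _]exprS (exprM Ci) Ci_sqr; ring.
Qed.

End Trigonometry.

Theorem lemma6p1 (R : realType) (s : CC R) (hs : forall n : int, s != n%:~R) :
  (forall T : CC R,
    (forall u : CC R,
       series (fun r : nat => multitangent T (nseq r 1%N) s * u ^+ r) @ \oo -->
         (Csin (Cpi * (s + u)) / Csin (Cpi * s) : CC R)) /\
    (forall m : nat,
       multitangent T (nseq (2 * m) 1%N) s =
         (-1) ^+ m * (Cpi ^+ (2 * m) / ((2 * m)`!)%:R)) /\
    (forall m : nat,
       multitangent T (nseq (2 * m).+1 1%N) s =
         (-1) ^+ m * (Cpi ^+ (2 * m).+1 / ((2 * m).+1`!)%:R)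
           * Ccot (Cpi * s))) /\
  (forall (T T' : CC R) (r : nat),
     multitangent T (nseq r 1%N) s = multitangent T' (nseq r 1%N) s).
Proof.
have value := multitangent_ones_value hs; split=> [T|T T' r]; last by rewrite !value.
split=> [u|].
  have -> : (fun r => multitangent T (nseq r 1%N) s * u ^+ r) =
      (fun r => ones_value s r * u ^+ r) by apply/funext => r; rewrite value.
  exact: cvg_ones_value_series.
by split=> m; rewrite value; [exact: ones_value_even|exact: ones_value_odd].
Qed.
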